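(* Let $G$ be an indecomposable graph with $v(G)\geq 14$. Then $\mathbb{I}(G)$ is $2$-covered if and only if $G$ or its complement $\overline{G}$ is isomorphic to an element $G'$ of $\mathcal{P}_{-1}\cup\mathcal{P}_{-3}\cup\mathcal{P}_{-5}\cup\mathcal{Q}_{-1}\cup\mathcal{Q}_{-3}\cup\mathcal{Q}_{-5}$ with $v(G')\geq 14$.
   Context: Graphs are finite, simple and undirected; $v(G)=|V(G)|$, $G[X]$ is the subgraph induced by $X$, $G-X=G[V(G)\setminus X]$, $G-x=G-\{x\}$. A subset $I\subseteq V(G)$ is an interval of $G$ if every vertex outside $I$ is adjacent to all or to none of the vertices of $I$. The sets $\emptyset$, $V(G)$ and $\{x\}$ ($x\in V(G)$) are the trivial intervals. $G$ is indecomposable if all its intervals are trivial. For an indecomposable graph $G=(V,E)$, the indecomposability graph $\mathbb{I}(G)$ has vertex set $V$, and its edges are the pairs $\{x,y\}$ of distinct vertices such that $G-\{x,y\}$ is indecomposable. A graph $H$ is $X$-covered, for $X\subseteq V(H)$, if every edge of $H$ meets $X$; $H$ is $k$-covered if it is $X$-covered for some $X\subseteq V(H)$ with $|X|=k$. Let $\mathbb{N}_n=\{1,\dots,n\}$. For $n\ge 1$, $P_n$ is the graph on $\mathbb{N}_n$ in which $i\ne j$ are adjacent iff $|i-j|=1$. For $n\geq 4$, $Q_n$ is the graph on $\mathbb{N}_n$ with edge set $E(P_{n-2})\cup\{\{n-1,i\}: i\in\mathbb{N}_n\setminus\{n-1,n-2\}\}$. For $k\in\{1,3,5\}$, $\mathcal{P}_{-k}$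 (resp. $\mathcal{Q}_{-k}$) is the set of indecomposable graphs $G$ with vertex set $\mathbb{N}_n$ such that $\mathbb{I}(G)$ is $\{1,n-k\}$-covered and $G-\{n-k+1,\dots,n\}=P_{n-k}$ (resp. $=Q_{n-k}$), where $n$ ranges over: $n\geq 9$ for $\mathcal{P}_{-1}$, $n\geq 12$ for $\mathcal{P}_{-3}$, $n\geq 14$ for $\mathcal{P}_{-5}$, $n\geq 11$ for $\mathcal{Q}_{-1}$, $n\geq 10$ for $\mathcal{Q}_{-3}$, $n\geq 12$ for $\mathcal{Q}_{-5}$. *)

(* Defs.v *)
From mathcomp Require Import all_boot.

Set Implicit Arguments.
Unset Strict Implicit.
Unset Printing Implicit Defensive.

Record sgraph (V : finType) := SGraph {
  adj :> rel V;
  adj_sym : symmetric adj;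
  adj_irr : irreflexive adj
}.

Section Graphs.
Variable V : finType.
Implicit Types (G H : sgraph V) (X I : {set V}).

Lemma induced_sym G X : symmetric (fun u v : {x : V | x \in X} => G (val u) (val v)).
Proof. by move=> u v; rewrite adj_sym. Qed.

Lemma induced_irr G X : irreflexive (fun u v : {x : V | x \in X} => G (val u) (val v)).
Proof. by move=> u; rewrite adj_irr. Qed.

Definition induced G X : sgraph {x : V | x \in X} :=
  SGraph (@induced_sym G X) (@induced_irr G X).

Definition delete G X := induced G (~: X).

Lemma compl_sym G : symmetric (fun x y => (x != y) && ~~ G x y).
Proof. by move=> x y; rewrite eq_sym adj_sym. Qed.

Lemma compl_irr G : irreflexive (fun x y => (x != y) && ~~ G x y).
Proof. by move=> x; rewrite eqxx. Qed.

Definition compl G : sgraph V := SGraph (@compl_sym G) (@compl_irr G).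

Definition interval G I : bool :=
  [forall x, (x \notin I) ==>
     ([forall y in I, G x y] || [forall y in I, ~~ G x y])].

Definition trivial_interval I : bool :=
  [|| I == set0, I == [set: V] | [exists x, I == [set x]]].

Definition indecomposable G : bool :=
  [forall I : {set V}, interval G I ==> trivial_interval I].

Definition covered_by H X : Prop :=
  forall x y, H x y -> (x \in X) || (y \in X).

Definition k_covered (k : nat) H : Prop :=
  exists2 X : {set V}, #|X| = k & covered_by H X.

End Graphs.

Section IndecomposabilityGraph.
Variables (V : finType) (G : sgraph V).

Let indec_adj (x y : V) : bool :=
  (x != y) && indecomposable (delete G [set x; y]).

Lemma indec_sym : symmetric indec_adj.
Proof. by move=> x y; rewrite /indec_adj eq_sym setUC. Qed.

Lemma indec_irr : irreflexive indec_adj.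
Proof. by move=> x; rewrite /indec_adj eqxx. Qed.

Definition indec_graph : sgraph V := SGraph indec_sym indec_irr.

End IndecomposabilityGraph.

Definition isomorphic (V W : finType) (G : sgraph V) (H : sgraph W) : Prop :=
  exists2 f : V -> W, bijective f & forall x y, H (f x) (f y) = G x y.

(* The vertex set {1, ..., n} is encoded as 'I_n, the ordinal i standing for
   the integer i + 1; all adjacencies below are expressed with these labels. *)
Definition lab (n : nat) (i : 'I_n) : nat := i.+1.

Definition consecutive (a b : nat) : bool := (a.+1 == b) || (b.+1 == a).

Lemma path_sym n : symmetric (fun i j : 'I_n => consecutive (lab i) (lab j)).
Proof. by move=> i j; rewrite /consecutive orbC. Qed.

Lemma path_irr n : irreflexive (fun i j : 'I_n => consecutive (lab i) (lab j)).
Proof. by move=> i; rewrite /consecutive orbb gtn_eqF. Qed.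

Definition P_graph (n : nat) : sgraph 'I_n := SGraph (@path_sym n) (@path_irr n).

(* The pair (a, b) of labels is an edge of P_(n-2), or a = n-1 and b is
   neither n-1 nor n-2, or the same with a and b exchanged. *)
Definition Q_adj (n a b : nat) : bool :=
  [|| [&& a <= n - 2, b <= n - 2 & consecutive a b],
      [&& a == n - 1, b != n - 1 & b != n - 2]
    | [&& b == n - 1, a != n - 1 & a != n - 2]].

Lemma Q_sym n : symmetric (fun i j : 'I_n => Q_adj n (lab i) (lab j)).
Proof.
move=> i j; rewrite /Q_adj /consecutive andbCA [X in _ || X]orbC.
by rewrite [X in [&& _, _ & X]]orbC.
Qed.

Lemma Q_irr n : irreflexive (fun i j : 'I_n => Q_adj n (lab i) (lab j)).
Proof.
by move=> i; rewrite /Q_adj /consecutive !orbb gtn_eqF // !andbF; case: eqP.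
Qed.

(* Only meaningful for 4 <= n. *)
Definition Q_graph (n : nat) : sgraph 'I_n := SGraph (@Q_sym n) (@Q_irr n).

(* G - {n-k+1, ..., n} = H as graphs on {1, ..., n-k}: equality of labelled
   graphs, not isomorphism ([widen_ord] preserves labels). *)
Definition initial_part_is (n k : nat) (G : sgraph 'I_n)
    (H : sgraph 'I_(n - k)) : Prop :=
  forall i j : 'I_(n - k),
    G (widen_ord (leq_subr k n) i) (widen_ord (leq_subr k n) j) = H i j.

Definition ends (n k : nat) : {set 'I_n} :=
  [set i | (lab i == 1) || (lab i == n - k)].

(* Membership in the class P_{-k} (resp. Q_{-k}) with the range n >= n0. *)
Definition in_P (k n0 n : nat) (G : sgraph 'I_n) : Prop :=
  [/\ n0 <= n, indecomposable G, covered_by (indec_graph G) (ends n k)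
    & initial_part_is G (P_graph (n - k))].

Definition in_Q (k n0 n : nat) (G : sgraph 'I_n) : Prop :=
  [/\ n0 <= n, indecomposable G, covered_by (indec_graph G) (ends n k)
    & initial_part_is G (Q_graph (n - k))].

Definition P_m1 (n : nat) (G : sgraph 'I_n) : Prop := in_P 1 9 G.
Definition P_m3 (n : nat) (G : sgraph 'I_n) : Prop := in_P 3 12 G.
Definition P_m5 (n : nat) (G : sgraph 'I_n) : Prop := in_P 5 14 G.
Definition Q_m1 (n : nat) (G : sgraph 'I_n) : Prop := in_Q 1 11 G.
Definition Q_m3 (n : nat) (G : sgraph 'I_n) : Prop := in_Q 3 10 G.
Definition Q_m5 (n : nat) (G : sgraph 'I_n) : Prop := in_Q 5 12 G.

Definition in_classes (n : nat) (G : sgraph 'I_n) : Prop :=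
  [\/ P_m1 G, P_m3 G | P_m5 G] \/ [\/ Q_m1 G, Q_m3 G | Q_m5 G].

(* Main.v *)
Require Import Defs.
From mathcomp Require Import all_boot.
From mathcomp Require Import zify.

(* Add an isolated vertex oo to the graph.  Intervals of G become cuts (A, B) of
   the enlarged vertex set on which ac + bc + ad + bd vanishes mod 2 for a, b in
   A and c, d in B.  This condition is symmetric in A and B and invariant under
   switching, and for it the paths P_m with ends x, y and the graphs Q_m are the
   same object: a path together with an isolated point, the three special
   points x, y, oo being the two ends of the path and the isolated point.
   (1) If x, y are nonadjacent in an indecomposable G, let C be the set of their
   common neighbours.  A shortest path from x to y in G - C induces some P_m.  If
   there is none, the union of the components of x and y in G - C is not an
   interval, so some vertex of it misses some c in C; a shortest path from x (or
   y) to a non-neighbour of c, together with c and the other vertex, induces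
   some Q_m.
   (2) If X is prime and at least 6 vertices lie outside X, two of them can be
   deleted so that G stays prime.  When their number is even, this follows by
   repeatedly adding two vertices to X.  Otherwise one looks for an odd set S
   with X + S prime.  If no such S has 1 or 3 elements, primality over X
   is governed by a bipartite-like graph gam on the outside vertices without
   isolated vertices and without twins.  If S cannot be an induced path on 5
   vertices either, neighbourhoods of gam sharing an element are nested, and
   sending a vertex to its neighbour of least degree is a fixed-point-free
   involution: the number of outside vertices is even.
   (3) If I(G) is {x, y}-covered, (2) applied to the set X of (1) leaves 0, 1, 3
   or 5 vertices outside X.  In the case of 0, dropping the first vertex of the
   sequence turns P_n or Q_n into P_(n-1) or Q_(n-1). *)

Set Implicit Arguments.
Unset Strict Implicit.
Unset Printing Implicit Defensive.

(** * Parity and fixed-point-free involutions *)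

Lemma even_card_involution (T : finType) (f : T -> T) (S : {set T}) :
  (forall x, x \in S -> [/\ f x \in S, f (f x) = x & f x != x]) -> ~~ odd #|S|.
Proof.
have [n] := ubnP #|S|; elim: n S => // n IH S le_n fS.
have [->|[x xS]] := set_0Vmem S; first by rewrite cards0.
have [fxS ffx nfx] := fS x xS.
have cS : #|S| = #|S :\ x :\ f x|.+2 by rewrite (cardsD1 x) (cardsD1 (f x)) !inE xS nfx fxS.
rewrite cS /= negbK; apply: IH; first by move: le_n; rewrite cS ltnS; apply: ltn_trans.
move=> y; rewrite !inE => /and3P[yfx yx yS]; have [fyS ffy nfy] := fS y yS.
split=> //; rewrite fyS andbT; apply/andP; split.
  by apply: contra yx => /eqP E; rewrite -ffy E ffx.
by apply: contra yfx => /eqP E; rewrite -E ffy.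
Qed.

(** * Flat cuts of a two-graph *)

Section TwoGraph.
Variables (W : finType) (e : rel W).
Hypothesis e_sym : symmetric e.
Implicit Types (A B X Y T : {set W}) (a b c d u v z : W).

(** Switching, that is adding [f u (+) f v] to each [e u v], leaves this sum unchanged. *)
Definition cross a b c d := (e a c (+) e b c) (+) (e a d (+) e b d).

(** Equivalently, [e a c] has the form [f a (+) g c] for [a] in A and [c] in Y minus A: some
    switching removes all edges across the cut. *)
Definition flat Y A := [forall a in A, forall b in A,
  forall c in Y :\: A, forall d in Y :\: A, ~~ cross a b c d].

Lemma flatP Y A : reflect
  (forall a b c d, a \in A -> b \in A -> c \in Y :\: A -> d \in Y :\: A ->
     cross a b c d = false) (flat Y A).
Proof.
apply: (iffP idP) => [/forall_inP fA a b c d aA bA cY dY | fA].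
  have /forall_inP/(_ _ bA)/forall_inP/(_ _ cY)/forall_inP/(_ _ dY) := fA _ aA.
  by move/negbTE.
by do 4![apply/forall_inP => ? ?]; rewrite fA.
Qed.

(** Cuts with at most one point on a side are always flat; they are the trivial ones. *)
Definition sprime Y :=
  [forall A : {set W}, (A \subset Y) ==> flat Y A ==>
     (#|A| <= 1) || (#|Y :\: A| <= 1)].

Lemma sprimeP Y : reflect
  (forall A, A \subset Y -> flat Y A -> (#|A| <= 1) || (#|Y :\: A| <= 1))
  (sprime Y).
Proof.
apply: (iffP forallP) => H A.
  by move=> AY fA; move/implyP/(_ AY)/implyP/(_ fA): (H A).
by apply/implyP => AY; apply/implyP => fA; apply: H.
Qed.

Lemma setDDK A Y : A \subset Y -> Y :\: (Y :\: A) = A.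
Proof. by move=> AY; rewrite setDDr setDv set0U; apply/setIidPr. Qed.

Lemma crossC a b c d : cross a b c d = cross c d a b.
Proof.
by rewrite /cross !(e_sym c) !(e_sym d); do 4!case: (e _ _).
Qed.

Lemma flatC Y A : A \subset Y -> flat Y (Y :\: A) = flat Y A.
Proof.
move=> AY; apply/flatP/flatP => fA a b c d aA bA cA dA.
  by rewrite crossC fA ?setDDK.
by rewrite setDDK // in cA dA; rewrite crossC fA.
Qed.

Lemma flat_sub X Y A : X \subset Y -> flat Y A -> flat X (A :&: X).
Proof.
move=> /subsetP XY /flatP fA; apply/flatP => a b c d.
rewrite !inE => /andP[aA _] /andP[bA _] /andP[nc cX] /andP[nd dX].
by apply: fA; rewrite // inE XY // andbT; [move: nc|move: nd]; rewrite ?cX ?dX andbT.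
Qed.

Lemma not_sprimeP Y z : z \in Y -> ~~ sprime Y ->
  exists A, [/\ A \subset Y, flat Y A, 1 < #|A|, 1 < #|Y :\: A| & z \in A].
Proof.
move=> zY /forallPn[A]; rewrite !negb_imply negb_or -!ltnNge.
case/and4P=> AY fA cA cB; have [zA | zA] := boolP (z \in A); first by exists A.
by exists (Y :\: A); rewrite subsetDl flatC // setDDK // inE zA.
Qed.

(** * Twin classes over a prime set *)

Section Classes.
Variable X : {set W}.
Hypotheses (X_prime : sprime X) (X_gt3 : 3 < #|X|).

(** Up to switching at [z], the points [u] and [z] have the same adjacency to X minus [u]. *)
Definition twin u z := [forall c in X :\ u, forall d in X :\ u, ~~ cross u z c d].

Lemma twinP u z : reflect
  (forall c d, c \in X -> c != u -> d \in X -> d != u -> cross u z c d = false)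
  (twin u z).
Proof.
apply: (iffP idP) => [/forall_inP tw c d cX cu dX du | tw].
  have cX' : c \in X :\ u by rewrite !inE cu.
  have /forall_inP/(_ d) := tw _ cX'; rewrite !inE du => /(_ dX).
  by move/negbTE.
by do 2![apply/forall_inP => ? /setD1P[? ?]]; rewrite tw.
Qed.

(** Two points of X with a common twin are twins of each other, so they would form one side of a
    flat cut of X with at least two points on each side. *)
Lemma twin_uniq u v z : u \in X -> v \in X -> twin u z -> twin v z -> u = v.
Proof.
move=> uX vX /twinP tu /twinP tv; apply/eqP/negPn/negP => nuv.
have sub : [set u; v] \subset X by rewrite subUset !sub1set uX.
have : flat X [set u; v].
  have key c d : c \in X :\: [set u; v] -> d \in X :\: [set u; v] ->
      cross u v c d = false.
    rewrite !inE !negb_or => /andP[/andP[cu cv] cX] /andP[/andP[du dv] dX].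
    move: (tu c d cX cu dX du) (tv c d cX cv dX dv); rewrite /cross.
    by do 6!case: (e _ _).
  apply/flatP => a b c d aA bA cX dX; move: (key c d cX dX).
  by case/set2P: aA => ->; case/set2P: bA => ->; rewrite /cross;
     do 4!case: (e _ _).
move/(sprimeP _ X_prime _ sub); rewrite cards2 nuv /= cardsD.
rewrite (setIidPr sub) cards2 nuv /= leq_subLR.
by case: #|X| X_gt3 => [|[|[|[|]]]].
Qed.

(** A nontrivial flat cut of [z |: X] restricts to a flat cut of X, which is trivial. The side
    without [z] keeps its two or more points, so the side of [z] consists of [z] and a single point
    of X. *)
Lemma ext_twin z : z \notin X -> ~~ sprime (z |: X) ->
  exists2 u, u \in X & twin u z.
Proof.
move=> zX /(not_sprimeP (setU11 _ _))[A [AY fA cA cB zA]].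
have fAX := flat_sub (subsetUr [set z] X) fA.
have eqB : (z |: X) :\: A = X :\: (A :&: X).
  apply/setP=> w; rewrite !inE; case: eqP => [->|_] /=; rewrite ?zA ?(negbTE zX) //=.
  by case: (w \in X); rewrite ?andbT ?andbF.
have := sprimeP _ X_prime _ (subsetIr A X) fAX.
rewrite -eqB (leqNgt _ 1) [X in _ || X]leqNgt cB orbF -leqNgt => cAX.
have eqA : A = z |: (A :&: X).
  apply/setP=> w; rewrite !inE; case: eqP => [->|/eqP wz] //=.
  case wA: (w \in A) => //=; move/subsetP/(_ _ wA): AY.
  by rewrite !inE (negbTE wz) /= => ->.
have : #|A :&: X| == 1.
  by rewrite eqn_leq cAX -ltnS -add1n; move: cA; rewrite {1}eqA cardsU1 !inE (negbTE zX) andbF.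
case/cards1P=> u eu; exists u; first by have: u \in A :&: X by [rewrite eu set11]; case/setIP.
apply/twinP=> c d cX cu dX du; move/flatP: fA; apply.
- by rewrite eqA eu !inE eqxx orbT.
- by [].
- by rewrite eqB eu !inE cu cX.
- by rewrite eqB eu !inE du dX.
Qed.

(** When no outside point extends X, each outside point has exactly one twin in X, and the fibres of
    [root] are the twin classes. *)
Definition root z := if z \in X then z else odflt z [pick u in X | twin u z].
Definition off u := odflt u [pick c in X :\ u].
(* With z switched so that it agrees with its twin [root z] on the rest of X,
   [dev p r] is the adjacency inside a twin class, and the deviation from the
   adjacency of the roots between two classes. *)
Definition dev p r :=
  if root p == root r
  then e p r (+) (e p (off (root p)) (+) e r (off (root p)))
  else (e p r (+) e (root p) r) (+) (e p (root r) (+) e (root p) (root r)).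

Lemma root_id z : z \in X -> root z = z.
Proof. by rewrite /root => ->. Qed.

Lemma offP u : u \in X -> (off u \in X) && (off u != u).
Proof.
move=> uX; rewrite /off; case: pickP => [c|no] /=.
  by rewrite !inE andbC.
have : X :\ u = set0 by apply/setP => c; rewrite no inE.
by move/eqP; rewrite -cards_eq0; move: X_gt3; rewrite (cardsD1 u X) uX; case: #|_|.
Qed.

Lemma offX u : u \in X -> off u \in X.
Proof. by case/offP/andP. Qed.

Lemma off_neq u : u \in X -> off u != u.
Proof. by case/offP/andP. Qed.

(** * Primality over a set without one-point extensions, in terms of [dev] *)

Section Critical.
Variable U : {set W}.
Hypotheses (XU : X \subset U)
  (no_ext : forall z, z \in U -> z \notin X -> ~~ sprime (z |: X)).

Lemma root_spec z : z \in U -> (root z \in X) && twin (root z) z.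
Proof.
move=> zU; rewrite /root; case: ifP => [zX | /negbT zX].
  rewrite zX; apply/twinP => c d _ _ _ _; rewrite /cross.
  by do 2!case: (e _ _).
case: pickP => [u //|no]; case: (ext_twin zX (no_ext zU zX)) => u uX tu.
by have := no u; rewrite uX tu.
Qed.

Lemma rootX z : z \in U -> root z \in X.
Proof. by case/root_spec/andP. Qed.

Lemma root_twin z : z \in U -> twin (root z) z.
Proof. by case/root_spec/andP. Qed.

Lemma root_uniq u z : z \in U -> u \in X -> twin u z -> root z = u.
Proof. by move=> zU uX; apply: twin_uniq (rootX zU) uX (root_twin zU). Qed.

Lemma devC p r : dev p r = dev r p.
Proof.
rewrite /dev eq_sym; case: eqP => [->|_]; rewrite (e_sym p r).
  by congr (_ (+) _); rewrite addbC.
rewrite (e_sym (root p) r) (e_sym p (root r)) (e_sym (root p)).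
by do 4!case: (e _ _).
Qed.

Lemma dev_root u r : u \in X -> root r != u -> dev u r = false.
Proof.
move=> uX; rewrite /dev (root_id uX) eq_sym => /negbTE->.
by do 2!case: (e _ _).
Qed.

(** Comparing [dev] on two members of a class thus tests flatness against the reference point
    [off (root a)]. If [d] is in another class, the twin relation trades the terms at [root d] for
    terms at the reference point. *)
Lemma dev_cross a b d : a \in U -> b \in U -> d \in U -> root a = root b ->
  dev a d (+) dev b d = cross a b d (off (root a)).
Proof.
move=> aU bU dU ab; rewrite /dev -ab; set u := root a; case: eqP => [_|/eqP ud].
  by rewrite /cross; do 5!case: (e _ _).
have uX : u \in X by apply: rootX.
have tw w : twin u w -> cross u w (root d) (off u) = false.
  by move/twinP; apply; rewrite ?rootX ?offX ?off_neq // eq_sym.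
have := tw _ (root_twin aU); have : twin u b by rewrite /u ab root_twin.
move/tw; rewrite /cross.
by move: (e a d) (e b d) (e u d) => [] [] []; do 7!case: (e _ _).
Qed.

(** One side of a flat cut of T meets X in at most one point. It lies in a single twin class, and
    points outside it do not distinguish its members by [dev]: it is a module of [dev]. *)
Lemma sprime_of_modules T : X \subset T -> T \subset U ->
  (forall A u, A \subset T -> u \in X -> {in A, forall p, root p = u} ->
     {in A &, forall p r, {in T :\: A, forall d, dev p d = dev r d}} ->
     #|A| <= 1) -> sprime T.
Proof.
move=> XT TU small; apply/sprimeP.
have aux A : A \subset T -> flat T A -> #|A :&: X| <= 1 -> #|A| <= 1.
  move=> AT fA cAX; have AU := subsetP (subset_trans AT TU).
  have [-> |[a aA]] := set_0Vmem A; first by rewrite cards0.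
  have fl p r c d : p \in A -> r \in A -> c \in X -> c \notin A -> d \in X ->
      d \notin A -> cross p r c d = false.
    move=> pA rA cX nc dX nd; move/flatP: fA; apply => //.
      by rewrite inE nc (subsetP XT).
    by rewrite inE nd (subsetP XT).
  (* If A misses X, its points all share the root of [a]; otherwise the common root is the only
     point of A in X. *)
  have [u uX rA] : exists2 u, u \in X & {in A, forall p, root p = u}.
    have [AX0 |[w /setIP[wA wX]]] := set_0Vmem (A :&: X).
      exists (root a); rewrite ?rootX ?AU // => p pA.
      apply: root_uniq (rootX (AU _ aA)) _; first exact: AU.
      have nA c : c \in X -> c \notin A.
        move=> cX; apply/negP => cA; have : c \in A :&: X by rewrite inE cA.
        by rewrite AX0 inE.
      apply/twinP => c d cX ca dX da.
      have := fl p a c d pA aA cX (nA _ cX) dX (nA _ dX).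
      have /twinP/(_ c d cX ca dX da) := root_twin (AU _ aA).
      by rewrite /cross; do 6!case: (e _ _).
    exists w => // p pA; apply: root_uniq (wX) _; first exact: AU.
    have nA c : c \in X -> c != w -> c \notin A.
      move=> cX; apply: contra => cA; apply/eqP.
      by apply: (card_le1_eqP cAX); rewrite inE ?cA ?wA.
    by apply/twinP => c d cX ca dX da; apply: fl; rewrite ?nA.
  apply: (small _ u) => // p r pA rA' d dTA.
  have dU : d \in U by case/setDP: dTA => /(subsetP TU).
  have := dev_cross (AU _ pA) (AU _ rA') dU (etrans (rA _ pA) (esym (rA _ rA'))).
  rewrite rA //.
  have /flatP-> // := fA; first by do 2!case: (dev _ _).
  have oX := offX uX; rewrite inE (subsetP XT) // andbT; apply/negP => oA.
  by have := off_neq uX; rewrite -(root_id oX) rA ?eqxx.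
move=> A AT fA.
have /orP[] := sprimeP _ X_prime _ (subsetIr A X) (flat_sub XT fA) => [cAX|cB].
  by rewrite aux.
rewrite [X in _ || X]aux ?orbT ?subsetDl ?flatC //.
apply: leq_trans cB; apply: subset_leq_card; apply/subsetP => w.
by rewrite !inE; case: (w \in A) => //= /andP[].
Qed.

(** Converse of [sprime_of_modules]: by [dev_cross], a module inside one class is a side of a flat
    cut, and the other side contains X minus [u], which has more than one point. *)
Lemma module_le1 T A u : X \subset T -> T \subset U -> sprime T -> A \subset T -> u \in X ->
  {in A, forall p, root p = u} ->
  {in A &, forall p r, {in T :\: A, forall d, dev p d = dev r d}} -> #|A| <= 1.
Proof.
move=> XT TU pT AT uX rA mA; have AU := subsetP (subset_trans AT TU).
have XA : X :\ u \subset T :\: A.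
  apply/subsetP => c; rewrite !inE => /andP[cu cX]; rewrite (subsetP XT) // andbT.
  by apply: contra cu => cA; rewrite -(rA _ cA) root_id.
have : flat T A.
  apply/flatP => a b c d aA bA cT dT.
  have rab := etrans (rA _ aA) (esym (rA _ bA)).
  have dU : d \in U by case/setDP: dT => /(subsetP TU).
  have cU : c \in U by case/setDP: cT => /(subsetP TU).
  have := dev_cross (AU _ aA) (AU _ bA) cU rab.
  have := dev_cross (AU _ aA) (AU _ bA) dU rab.
  rewrite (mA _ _ aA bA _ cT) (mA _ _ aA bA _ dT) !addbb /cross.
  by do 6!case: (e _ _).
move/(sprimeP _ pT _ AT)/orP => [//|/(leq_trans (subset_leq_card XA))].
by move: X_gt3; rewrite (cardsD1 u X) uX; case: #|_| => [|[|]].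
Qed.

(** A module inside one class contains no point of X but the root. The hypotheses separate each
    point of S from its root and from the other points of S in its class, always by a point of
    another class, hence outside the module. *)
Lemma sprime_separated (S : {set W}) : S \subset U ->
  (forall p, p \in S -> exists2 d, d \in S & (root d != root p) && dev p d) ->
  (forall p r, p \in S -> r \in S -> p != r -> root p = root r ->
     exists2 d, d \in S & (root d != root p) && (dev p d != dev r d)) ->
  sprime (X :|: S).
Proof.
move=> SU sepX sepS; have SU' := subsetP SU.
apply: sprime_of_modules; rewrite ?subsetUl ?subUset ?XU //.
move=> A u AXS uX rA mA; rewrite leqNgt; apply/negP => /card_gt1P[p [r [pA rA' npr]]].
have no_sep a b d : a \in A -> b \in A -> d \in S -> root d != root a ->
    dev a d = dev b d.
  move=> aA bA dS nd; apply: mA; rewrite ?inE ?dS ?orbT ?andbT //.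
  by apply: contra nd => dA; rewrite !rA.
have main a b : a \in A -> b \in A -> a != b -> a \in S -> False.
  move=> aA bA nab aS; have := subsetP AXS _ bA; case/setUP => [bX|bS].
    have [d dS /andP[nd]] := sepX _ aS.
    rewrite (no_sep a b) // dev_root //.
    by rewrite -[b]root_id ?(rA _ bA) -?(rA _ aA).
  have [|d dS /andP[nd]] := sepS _ _ aS bS nab; first by rewrite !rA.
  by rewrite (no_sep a b) ?eqxx.
have [pS|pS] := boolP (p \in S); first by apply: (main p r).
have [rS|rS] := boolP (r \in S); first by apply: (main r p); rewrite // eq_sym.
have pX : p \in X by have := subsetP AXS _ pA; rewrite inE (negbTE pS) orbF.
have rX : r \in X by have := subsetP AXS _ rA'; rewrite inE (negbTE rS) orbF.
by case/eqP: npr; rewrite -(root_id pX) -(root_id rX) !rA.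
Qed.

Lemma sprime_pair a b : a \in U -> b \in U -> root a != root b -> dev a b ->
  sprime (X :|: [set a; b]).
Proof.
move=> aU bU nab dab; apply: sprime_separated.
- by rewrite subUset !sub1set aU.
- move=> p /set2P[]->; first by exists b; rewrite ?set22 // dab eq_sym nab.
  by exists a; rewrite ?set21 // devC dab nab.
- move=> p r /set2P[]-> /set2P[]->; rewrite ?eqxx // => _ E; by rewrite E eqxx in nab.
Qed.

End Critical.

(** If [dev] vanished between classes, the whole class of an outside point, root included, would be
    a module of W with two or more points. *)
Lemma dev_edge : sprime [set: W] -> X != [set: W] ->
  (forall z, z \notin X -> ~~ sprime (z |: X)) ->
  exists a b, [/\ a \notin X, b \notin X, root a != root b & dev a b].
Proof.
move=> pW nX no_ext; pose U := [set: W].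
have no_ext' z : z \in U -> z \notin X -> ~~ sprime (z |: X) by move=> _; apply: no_ext.
have XU : X \subset U by apply: subsetT.
have [/existsP[a /existsP[b /andP[nab dab]]]|/existsPn none] :=
    boolP [exists a, exists b, (root a != root b) && dev a b].
  exists a, b; split=> //; apply/negP => cX; move: dab.
    by rewrite dev_root // eq_sym -{1}(root_id cX).
  by rewrite devC dev_root // -{1}(root_id cX).
have [z zX] : exists z, z \notin X.
  by move: nX; rewrite -subTset => /subsetPn[z _]; exists z.
pose A := [set p | root p == root z]; have zU : z \in U by rewrite inE.
have : 1 < #|A|.
  apply/card_gt1P; exists z, (root z); rewrite !inE eqxx.
  rewrite (root_id (rootX no_ext' zU)) eqxx; split=> //.
  by apply: contraNneq zX => ->; apply: rootX no_ext' _ zU.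
rewrite ltnNge => /negP[].
apply: (module_le1 no_ext' (T := setT) (u := root z)); rewrite ?subsetT //.
- exact: rootX no_ext' _ zU.
- by move=> p; rewrite inE => /eqP.
have dev0 p d : p \in A -> d \notin A -> dev p d = false.
  rewrite !inE => /eqP Ep nd; apply/negbTE/negP => dpd.
  by have /existsPn/(_ d) := none p; rewrite dpd Ep andbT eq_sym nd.
by move=> p r pA rA d /setDP[_ dA]; rewrite !dev0.
Qed.

Lemma twin_not_ext u z : u \in X -> z \notin X -> twin u z -> ~~ sprime (z |: X).
Proof.
move=> uX zX /twinP tw; have nuz : u != z by apply: contraNneq zX => <-.
have sub : [set u; z] \subset z |: X by rewrite subUset !sub1set !inE uX eqxx orbT.
have eqD : (z |: X) :\: [set u; z] = X :\ u.
  apply/setP => w; rewrite !inE negb_or; case: (eqVneq w z) => [->|_] /=.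
    by rewrite (negbTE zX) !andbF.
  by rewrite andbT.
apply/negP => /sprimeP/(_ _ sub); rewrite cards2 nuz eqD.
have XX : 1 < #|X :\ u|.
  by move: X_gt3; rewrite (cardsD1 u X) uX; case: #|_| => [|[|]].
rewrite [X in _ || X]leqNgt XX => fl; suff /fl: flat (z |: X) [set u; z] by [].
have key c d : c \in X :\ u -> d \in X :\ u -> cross u z c d = false.
  by case/setD1P=> ? ? /setD1P[? ?]; rewrite tw.
apply/flatP; rewrite eqD => a b c d /set2P[]-> /set2P[]-> /key cX /cX;
  by rewrite /cross; do 4!case: (e _ _).
Qed.

End Classes.

Lemma twin_sub X Y u z : X \subset Y -> twin Y u z -> twin X u z.
Proof.
move=> /subsetP XY /twinP tw; apply/twinP => c d cX cu dX du.
by rewrite tw ?XY.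
Qed.

(* The Ehrenfeucht-Rozenberg extension theorem.  When some a extends X, the
   argument is applied to a |: X, where no further point is an extension. *)
Lemma two_ext X : sprime X -> 3 < #|X| -> sprime [set: W] -> 1 < #|~: X| ->
  exists a b, [/\ a \notin X, b \notin X, a != b & sprime (X :|: [set a; b])].
Proof.
move=> pX X_gt3 pW codim.
have nT (Z : {set W}) : #|Z| < #|W| -> Z != [set: W].
  by apply: contraTneq => ->; rewrite cardsT ltnn.
have cXW := cardsC X; have XT : X != [set: W].
  by apply: nT; rewrite -cXW -addn1 leq_add2l ltnW.
have [/forall_inP noX|] := boolP [forall z in ~: X, ~~ sprime (z |: X)].
  have noX' z : z \notin X -> ~~ sprime (z |: X) by move=> zX; apply: noX; rewrite inE.
  have [a [b [aX bX nab dab]]] := dev_edge pX X_gt3 pW XT noX'.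
  exists a, b; split=> //; first by apply: contraNneq nab => ->.
  by apply: (sprime_pair pX X_gt3 (subsetT X)) => // z _; apply: noX'.
case/forall_inPn=> a; rewrite inE => aX /negPn; set Y := a |: X => pY.
have [/forall_inP noY|] := boolP [forall z in ~: Y, ~~ sprime (z |: Y)]; last first.
  case/forall_inPn=> b; rewrite !inE negb_or => /andP[ba bX] /negPn pb.
  exists a, b; split=> //; first by rewrite eq_sym.
  by rewrite setUC -setUA setUCA.
have Y_gt3 : 3 < #|Y| by rewrite cardsU1 aX ltnW.
have YT : Y != [set: W].
  by apply: nT; rewrite cardsU1 aX -cXW addnC ltn_add2l.
have noY' z : z \notin Y -> ~~ sprime (z |: Y) by move=> zX; apply: noY; rewrite inE.
have noYT z : z \in setT -> z \notin Y -> ~~ sprime (z |: Y) by move=> _; apply: noY'.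
have XY : X \subset Y by apply: subsetUr.
have [b [b' [bY bY' nbb dbb]]] := dev_edge pY Y_gt3 pW YT noY'.
(* The two roots differ, so at most one of them is [a]. *)
wlog rb : b b' bY bY' nbb dbb / root Y b != a.
  move=> IH; have [E|] := eqVneq (root Y b) a; last exact: IH bY bY' nbb dbb.
  apply: (IH b' b) => //; first by rewrite eq_sym.
    by rewrite devC.
  by apply: contraNneq nbb => ->; apply/eqP.
have rX z : root Y z != a -> root Y z \in X.
  have := rootX pY noYT (in_setT z); rewrite /Y !inE.
  by case: eqP.
have notX z : z \notin Y -> z \notin X by apply/contra/subsetP.
have tw z := root_twin pY noYT (in_setT z).
have twX z : twin X (root Y z) z := twin_sub XY (tw z).
have ext z : z \notin Y -> root Y z != a -> ~~ sprime (z |: X).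
  by move=> zY rz; apply: twin_not_ext (twX z); rewrite ?rX ?notX.
have bb : b != b' by apply: contraNneq nbb => ->.
exists b, b'; split; rewrite ?notX //.
(* If neither root is [a], roots over X and over Y agree on [b] and [b']. So does [dev], which
   between classes depends only on the roots. *)
have [rb'|rb'] := eqVneq (root Y b') a; last first.
  pose U := X :|: [set b; b'].
  have XU : X \subset U by apply: subsetUl.
  have noU z : z \in U -> z \notin X -> ~~ sprime (z |: X).
    by move=> /setUP[->//|/set2P[]-> _]; apply: ext.
  have bU : b \in U by rewrite !inE eqxx orbT.
  have bU' : b' \in U by rewrite !inE eqxx !orbT.
  have rr z : z \in U -> z \notin Y -> root Y z != a -> root X z = root Y z.
    by move=> zU zY rz; apply: (root_uniq pX X_gt3 noU) => //; apply: rX.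
  apply: (sprime_pair pX X_gt3 XU noU) => //; first by rewrite !rr.
  by move: dbb; rewrite /dev !rr // (negbTE nbb).
(* Since [b'] is a twin of [a], a twin of [b'] in X would be a twin of [a], but [a] extends X. *)
have pb' : sprime (b' |: X).
  apply/negPn/negP => /(ext_twin pX (notX _ bY'))[w wX /twinP tww].
  suff /(twin_not_ext X_gt3 wX aX)/negP[] : twin X w a by [].
  apply/twinP => c d cX cw dX dw; have := tww c d cX cw dX dw.
  have /twinP := tw b'; rewrite rb' => /(_ c d).
  have nXa x : x \in X -> (x \in Y) * (x != a).
    by move=> xX; rewrite (subsetP XY) //; split=> //; apply: contraNneq aX => <-.
  rewrite !nXa // => /(_ isT isT isT isT).
  by rewrite /cross; do 6!case: (e _ _).
set Y2 := b' |: X in pb'.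
have Y2_gt3 : 3 < #|Y2| by rewrite cardsU1 notX // ltnW.
have bY2 : b \notin Y2 by rewrite !inE negb_or bb notX.
have -> : X :|: [set b; b'] = b |: Y2 by rewrite setUC -setUA.
apply/negPn/negP => /(ext_twin pb' bY2)[w wY tww].
have [Ew|nw] := eqVneq w b'.
  suff /(twin_not_ext X_gt3 (rX _ rb) (notX _ bY'))/negP[] :
    twin X (root Y b) b' by [].
  apply/twinP => c d cX cu dX du.
  have /twinP/(_ c d cX cu dX du) := twX b.
  have nb x : x \in X -> (x \in Y2) * (x != b').
    by move=> xX; rewrite !inE xX orbT; split=> //; apply: contraNneq (notX _ bY') => <-.
  have /twinP := tww; rewrite Ew => /(_ c d).
  rewrite !nb // => /(_ isT isT isT isT).
  by rewrite /cross; do 6!case: (e _ _).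
have wX : w \in X by move: wY; rewrite !inE (negbTE nw).
have Ew : w = root Y b.
  by apply: (twin_uniq pX X_gt3 wX (rX _ rb) _ (twX b)); apply: twin_sub tww; apply: subsetUr.
have oX := offX X_gt3 wX; have on := off_neq X_gt3 wX; set c := off X w in oX on.
have h1 : cross w b a c = false.
  have := tw b; rewrite -Ew => /twinP; apply=> //; last exact: (subsetP XY).
    exact: setU11.
  by rewrite Ew eq_sym.
have h2 : cross w b b' c = false.
  move/twinP: tww; apply=> //; first exact: setU11.
    by rewrite eq_sym.
  by rewrite inE oX orbT.
(* The two vanishing sums [h1] and [h2] add up to [dev Y b b'], which is 1. *)
move: dbb h1 h2; rewrite /dev (negbTE nbb) rb' -Ew /cross.
by do 6!case: (e _ _).
Qed.

Lemma even_codim_two X : sprime X -> 3 < #|X| -> sprime [set: W] ->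
  0 < #|~: X| -> ~~ odd #|~: X| ->
  exists Y, [/\ X \subset Y, sprime Y & #|~: Y| = 2].
Proof.
move=> + + pW; have [n] := ubnP #|~: X|; elim: n X => // n IH X le_n pX X3 c0 cE.
have c1 : 1 < #|~: X| by move: c0 cE; case: #|_| => [|[|]].
have [c2|c2] := eqVneq #|~: X| 2; first by exists X.
have [a [b [aX bX nab pY]]] := two_ext pX X3 pW c1.
set Y := X :|: _ in pY; have XY : X \subset Y by apply: subsetUl.
have cY : #|~: X| = #|~: Y|.+2.
  have E : #|Y| = #|X|.+2 by rewrite /Y setUC -setUA !cardsU1 !inE negb_or nab aX bX.
  by apply/eqP; rewrite -(eqn_add2l #|X|) cardsC -(cardsC Y) E !addSnnS.
have [|||||Z [YZ pZ cZ]] := IH Y.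
- by move: le_n; rewrite cY ltnS; apply: ltn_trans.
- exact: pY.
- by apply: leq_trans X3 _; apply: subset_leq_card.
- by move: c2; rewrite cY; case: #|_|.
- by move: cE; rewrite cY /= negbK.
by exists Z; split=> //; apply: subset_trans YZ.
Qed.

(** * Prime subsets of codimension two *)

Section OddCodim.
Variable X : {set W}.
Hypotheses (X_prime : sprime X) (X_gt3 : 3 < #|X|) (W_prime : sprime [set: W]).
Hypothesis no_odd : forall S : {set W}, S \subset ~: X -> odd #|S| -> #|S| <= 5 ->
  ~~ sprime (X :|: S).

Let rt := root X.
Let dv := dev X.
(** By [sprime_pair], X stays prime when both ends of an edge of [gam] are added. *)
Definition gam a b := (rt a != rt b) && dv a b.

Let XT : X \subset [set: W] := subsetT X.

Lemma no_one_point_extension z : z \in [set: W] -> z \notin X -> ~~ sprime (z |: X).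
Proof.
by move=> _ zX; rewrite setUC no_odd ?cards1 // sub1set inE.
Qed.

Let rtX z : rt z \in X. Proof. by apply: rootX no_one_point_extension _ (in_setT z). Qed.
Let rt_id z : z \in X -> rt z = z. Proof. exact: root_id. Qed.
Let dvC p r : dv p r = dv r p. Proof. exact: devC. Qed.
Let dv_root u r : u \in X -> rt r != u -> dv u r = false.
Proof. exact: dev_root. Qed.

Lemma gamC a b : gam a b = gam b a.
Proof. by rewrite /gam eq_sym dvC. Qed.

Lemma gam_out a b : gam a b -> a \notin X.
Proof.
case/andP=> nab; apply: contraL => aX; rewrite dv_root //.
by rewrite eq_sym -(rt_id aX).
Qed.

Lemma gam_outr a b : gam a b -> b \notin X.
Proof. by rewrite gamC; apply: gam_out. Qed.

Lemma gam_neq a b : gam a b -> a != b.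
Proof. by case/andP=> nab _; apply: contraNneq nab => ->. Qed.

(** With three different roots, the edges of the path [a], [b], [c] would separate each point from
    its root, making X with these three points prime. So a component of [gam] meets at most two
    classes. *)
Lemma gam_trans a b c : gam a b -> gam b c -> rt a = rt c.
Proof.
move=> ab bc; apply/eqP/negPn/negP => nac.
have nac' : a != c by apply: contraNneq nac => ->.
have [aX bX cX] := And3 (gam_out ab) (gam_outr ab) (gam_outr bc).
have cS : #|[set a; b; c]| = 3.
  by rewrite setUC cardsU1 cards2 !inE negb_or !(eq_sym c) nac' (gam_neq bc) (gam_neq ab).
have /negP[] : ~~ sprime (X :|: [set a; b; c]).
  by apply: no_odd; rewrite ?cS // !subUset !sub1set !inE aX bX cX.
have [/andP[nab dab] /andP[nbc dbc]] := (ab, bc).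
apply: (sprime_separated X_prime X_gt3 XT no_one_point_extension); rewrite ?subsetT // -/rt -/dv.
- move=> p; rewrite !inE -orbA => /or3P[]/eqP->.
  + by exists b; rewrite ?inE ?eqxx ?orbT // eq_sym nab.
  + by exists c; rewrite ?inE ?eqxx ?orbT // eq_sym nbc.
  + by exists b; rewrite ?inE ?eqxx ?orbT // nbc dvC.
- move=> p r; rewrite !inE -!orbA => /or3P[]/eqP-> /or3P[]/eqP->;
  rewrite ?eqxx // => _ E.
  all: by [rewrite E eqxx in nab | rewrite E eqxx in nbc | rewrite E eqxx in nac].
Qed.

(** In the class of [a] the candidates for a module are [a], [a'] and the root. The point [c]
    separates its neighbours from the root and from its non-neighbours; the pair that remains is
    [a], [a'], separated by the root, or [a'] and the root, separated by [a]. *)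
Lemma sprime_three a a' c : gam c a -> a' \notin X -> a != a' -> rt a' = rt a ->
  (if dv c a' then dv (rt a) a != dv (rt a) a' else dv a a' != dv a (rt a)) ->
  sprime (X :|: [set a; a'; c]).
Proof.
move=> ca a'X naa Ea H; have [nca dca] := andP ca.
have [cX aX] := conj (gam_out ca) (gam_outr ca).
apply: (sprime_of_modules X_prime X_gt3 no_one_point_extension); rewrite ?subsetUl ?subsetT //.
move=> A u AT uX rA mA; rewrite leqNgt; apply/negP => /card_gt1P[p [r [pA rA' npr]]].
have no_sep x y d : x \in A -> y \in A -> d \notin A -> d \in X :|: [set a; a'; c] ->
    dv x d = dv y d.
  by move=> xA yA dA dT; apply: mA; rewrite // inE dA.
have rAu x : x \in A -> rt x = u by apply: rA.
have cT : c \in X :|: [set a; a'; c] by rewrite !inE eqxx !orbT.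
have aT : a \in X :|: [set a; a'; c] by rewrite !inE eqxx !orbT.
have uT : rt a \in X :|: [set a; a'; c] by rewrite inE rtX.
have memA x : x \in A -> [|| x == u, x == a, x == a' | x == c].
  move=> xA; have := subsetP AT _ xA; rewrite !inE -!orbA => /orP[xX|->]; last by rewrite orbT.
  by rewrite -(rAu x xA) rt_id // eqxx.
(* Otherwise A consists of [c] and its root, which [a] separates. *)
have cA : c \notin A.
  apply/negP => cA; have uc := rAu _ cA.
  have aA : a \notin A by apply: contra nca => aA; rewrite !rAu.
  have a'A : a' \notin A by apply: contra nca => a'A; rewrite -Ea !rAu.
  have uA : u \in A.
    have [/eqP Ep|pc] := boolP (p == c).
      have := memA _ rA'; rewrite -Ep [r == p]eq_sym (negbTE npr) orbF.
      case/or3P=> /eqP E; first by rewrite -E.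
        by rewrite -E rA' in aA.
      by rewrite -E rA' in a'A.
    have := memA _ pA; rewrite (negbTE pc) orbF.
    case/or3P=> /eqP E; first by rewrite -E.
      by rewrite -E pA in aA.
    by rewrite -E pA in a'A.
  by have := no_sep c u a cA uA aA aT; rewrite dca dv_root // -uc eq_sym.
have au : u = rt a.
  have [aA|aA] := boolP (a \in A); first by rewrite rAu.
  have [a'A|a'A] := boolP (a' \in A); first by rewrite -Ea rAu.
  have Eu x : x \in A -> x = u.
    move=> xA; case/or4P: (memA _ xA) => /eqP // E; rewrite E in xA.
    - by rewrite xA in aA.
    - by rewrite xA in a'A.
    - by rewrite xA in cA.
  by rewrite (Eu p) // (Eu r) ?eqxx in npr.
have dcu : dv u c = false by rewrite dv_root // au.
have aNu : a \in A -> u \notin A.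
  by move=> aA; apply/negP => uA; have := no_sep a u c aA uA cA cT; rewrite dvC dca dcu.
have memA' x : x \in A -> [|| x == u, x == a | x == a'].
  move=> xA; have := memA _ xA; case: (eqVneq x c) => [E|]; last by rewrite orbF.
  by rewrite -E xA in cA.
(* A has two distinct members [p] and [r], so if one of three candidates is missing, the other two
   are present. *)
have both x y z : (forall w, w \in A -> [|| w == x, w == y | w == z]) -> x \notin A ->
    (y \in A) && (z \in A).
  move=> mem xA; have m w : w \in A -> (w == y) || (w == z).
    by move=> wA; have := mem w wA; case: eqP => // E; rewrite -E wA in xA.
  have [mp mr] := (m _ pA, m _ rA'); move: mp mr pA rA' npr.
  by do 2![case/orP=> /eqP->]; rewrite ?eqxx // => -> ->.
case da': (dv c a') H => H.
  have a'Nu : a' \in A -> u \notin A.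
    by move=> aA; apply/negP => uA; have := no_sep a' u c aA uA cA cT; rewrite dvC da' dcu.
  have uA : u \notin A.
    apply/negP => uA; have naA : a \notin A by apply/negP => /aNu; rewrite uA.
    have /andP[_ /a'Nu] : (u \in A) && (a' \in A).
      by apply: (both a) => // x /memA'/or3P[]->; rewrite ?orbT.
    by rewrite uA.
  have /andP[aA a'A] := both _ _ _ memA' uA.
  by have := no_sep a a' (rt a) aA a'A; rewrite uT -au uA => /(_ isT isT) E;
     rewrite -au !(dvC u) E eqxx in H.
have naa' : a \in A -> a' \notin A.
  by move=> aA; apply/negP => a'A; have := no_sep a a' c aA a'A cA cT; rewrite !(dvC _ c) dca da'.
have aA : a \notin A.
  apply/negP => aA; have /andP[_ a'A] : (a \in A) && (a' \in A).
    by apply: (both u); rewrite ?aNu.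
  by have := naa' aA; rewrite a'A.
have /andP[uA a'A] : (u \in A) && (a' \in A).
  by apply: (both a) => // x /memA'/or3P[]->; rewrite ?orbT.
by have := no_sep a' u a a'A uA aA aT; rewrite !(dvC _ a) => E; rewrite -au E eqxx in H.
Qed.

(** Without three-point extensions, [gam] dictates [dev] inside a class: neighbours of [c] deviate
    equally from the root, and to [a] a non-neighbour of [c] looks like the root. *)
Lemma no_three a a' c : gam c a -> a' \notin X -> a != a' -> rt a' = rt a ->
  if dv c a' then dv (rt a) a = dv (rt a) a' else dv a a' = dv a (rt a).
Proof.
move=> ca a'X naa Ea; have := sprime_three ca a'X naa Ea.
have [cX aX] := conj (gam_out ca) (gam_outr ca).
have nca := gam_neq ca.
have nca' : c != a' by apply: contraTneq ca => ->; rewrite /gam Ea eqxx.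
have /negPf-> : ~~ sprime (X :|: [set a; a'; c]).
  have cS : #|[set a; a'; c]| = 3.
    by rewrite setUC cardsU1 cards2 !inE negb_or nca nca' naa.
  by apply: no_odd; rewrite ?cS // !subUset !sub1set !inE aX a'X cX.
by case: (dv c a'); case: eqP => // _ /(_ isT).
Qed.

Lemma gam_root_const a a' c : gam c a -> gam c a' -> dv (rt a) a = dv (rt a) a'.
Proof.
move=> ca ca'; have [->//|naa] := eqVneq a a'.
have := no_three ca (gam_outr ca') naa _; case/andP: (ca') => _ -> -> //.
by apply: gam_trans (_ : gam a' c) ca; rewrite gamC.
Qed.

Lemma gam_root_eq a a' c : gam c a -> a' \notin X -> a != a' -> rt a' = rt a ->
  ~~ dv c a' -> dv a a' = dv a (rt a).
Proof. by move=> ca a'X naa Ea /negPf E; have := no_three ca a'X naa Ea; rewrite E. Qed.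

(** Otherwise the isolated points of the class of [a], with the root, form a module. A point [d] of
    the class outside it has a neighbour [c], and by [gam_root_eq] it deviates from non-neighbours
    of [c] as from the root. *)
Lemma gam_nonisolated a : a \notin X -> exists b, gam a b.
Proof.
move=> aX; have [/existsP//|/existsPn iso] := boolP [exists b, gam a b].
pose Z := [set z | (rt z == rt a) && ((z \in X) || [forall b, ~~ gam z b])].
have : 1 < #|Z|.
  apply/card_gt1P; exists a, (rt a); rewrite !inE rtX (rt_id (rtX a)) !eqxx.
  split=> //; first by apply/orP; right; apply/forallP.
  by apply: contraNneq aX => ->.
rewrite ltnNge => /negP[].
apply: (module_le1 X_prime X_gt3 no_one_point_extension XT _ W_prime _ (rtX a)); rewrite ?subsetT //.
  by move=> p; rewrite inE => /andP[/eqP].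
have key p d : p \in Z -> d \notin Z -> dv p d = (rt d == rt a) && dv (rt a) d.
  rewrite !inE => /andP[/eqP Ep pX]; rewrite negb_and negb_or.
  have [Ed /=|nd _ /=] := eqVneq (rt d) (rt a); last first.
    case/orP: pX => [pX|/forallP/(_ d)]; first by rewrite dv_root // -(rt_id pX) Ep.
    by rewrite /gam Ep eq_sym nd => /negPf.
  case/andP=> dX /forallPn[c /negPn dc].
  case/orP: pX => [pX|/forallP pX]; first by rewrite -Ep rt_id.
  have [pX'|pX'] := boolP (p \in X); first by rewrite -Ep rt_id.
  rewrite dvC (@gam_root_eq d p c) ?Ed //.
  - by rewrite gamC.
  - by apply: contraTneq dc => ->; apply: pX.
  - by have := pX c; have /andP[ndc _] := dc; rewrite gamC /gam Ep -Ed eq_sym ndc.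
by move=> p r pZ rZ d /setDP[_ dZ]; rewrite -/dv (key p d) // (key r d).
Qed.

(** The points of the class of [a] with the same neighbours as [a] form a module. For [d] in the
    class, a point [c] telling [d] from [a] reduces [dev] at [d] to a deviation from the root. *)
Lemma gam_twin_free a b : a \notin X -> rt b = rt a ->
  (forall c, gam c a = gam c b) -> a = b.
Proof.
move=> aX Eb Eab.
have [c0 ac0] := gam_nonisolated aX.
pose Z := [set z | (rt z == rt a) && [forall c, gam c a == gam c z]].
have : #|Z| <= 1.
  apply: (module_le1 X_prime X_gt3 no_one_point_extension XT _ W_prime _ (rtX a)); rewrite ?subsetT //.
    by move=> p; rewrite inE => /andP[/eqP].
  have ZP p : p \in Z -> rt p = rt a /\ forall c, gam c p = gam c a.
    by rewrite inE => /andP[/eqP-> /forallP H]; split=> // c; rewrite (eqP (H c)).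
  have sgn p : p \in Z -> dv (rt a) p = dv (rt a) a.
    move=> /ZP[Ep Gp]; rewrite -Ep; apply: (@gam_root_const _ _ c0); first by rewrite Gp gamC.
    by rewrite gamC.
  have outZ p : p \in Z -> p \notin X.
    by move=> /ZP[_ Gp]; apply: (@gam_outr c0); rewrite Gp gamC.
  move=> p r pZ rZ d /setDP[_ dZ]; rewrite -/dv.
  have [[Ep Gp] [Er Gr]] := (ZP _ pZ, ZP _ rZ).
  have [Ed|nd] := eqVneq (rt d) (rt a); last first.
    by have := Gp d; rewrite -Gr /gam Ep Er nd !(dvC d).
  have [dX|dX] := boolP (d \in X).
    by rewrite -(rt_id dX) Ed !(dvC _ (rt a)) !sgn.
  have [npd nrd] : p != d /\ r != d by split; apply: contraNneq dZ => <-.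
  move: dZ; rewrite inE Ed eqxx => /forallPn[c].
  have [ca|nca] := boolP (gam c a) => gcd.
    have ncd : ~~ dv c d.
      by apply: contra gcd => dcd; rewrite /gam Ed dcd; case/andP: ca => ->.
    rewrite (@gam_root_eq p d c) ?Gp ?Ep // (@gam_root_eq r d c) ?Gr ?Er //.
    by rewrite !(dvC _ (rt a)) !sgn.
  have {}gcd : gam c d by case: (gam c d) gcd.
  have no z : z \in Z -> ~~ dv c z.
    move=> /ZP[Ez Gz]; rewrite -Gz // /gam Ez in nca.
    by case/andP: gcd nca; rewrite Ed => ->.
  rewrite !(dvC _ d) (@gam_root_eq d p c) ?outZ ?Ep ?no //; last by rewrite eq_sym.
  by rewrite (@gam_root_eq d r c) ?outZ ?Er ?no // eq_sym.
move/card_le1_eqP; apply; rewrite inE ?Eb eqxx; apply/forallP => c //.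
by rewrite Eab.
Qed.

(** * Nested neighbourhoods and the involution *)

Definition nbh a := [set b | gam a b].

(* Otherwise c - a - d - a' - c' is an induced path of gam. *)
Lemma nbh_comparable a a' d : gam d a -> gam d a' ->
  (nbh a \subset nbh a') || (nbh a' \subset nbh a).
Proof.
move=> da da'; apply/negPn/negP; rewrite negb_or.
case/andP=> /subsetPn[c]; rewrite !inE => ac na'c /subsetPn[c']; rewrite !inE => a'c' nac'.
have Ea : rt a' = rt a by apply: gam_trans (_ : gam a' d) da; rewrite gamC.
have Ec : rt c = rt d by apply: gam_trans (_ : gam c a) _; rewrite gamC.
have Ec' : rt c' = rt d by apply: gam_trans (_ : gam c' a') _; rewrite gamC.
have [nda dda] := andP da; have /andP[_ dda'] := da'.
have /andP[_ dac] := ac; have /andP[_ da'c'] := a'c'.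
have ndac' : dv a c' = false.
  by move: nac'; rewrite /gam Ec' eq_sym nda => /negbTE.
have nda'c : dv a' c = false.
  by move: na'c; rewrite /gam Ea Ec eq_sym nda => /negbTE.
pose S := [set a; a'] :|: [set c; c'; d].
have naa : a != a' by apply: contraNneq na'c => <-.
have ncc : c != c' by apply: contraNneq nac' => <-.
have ncd : c != d by apply: contraNneq na'c => ->; rewrite gamC.
have nc'd : c' != d by apply: contraNneq nac' => ->; rewrite gamC.
have cS : #|S| = 5.
  rewrite cardsU (_ : _ :&: _ = set0) ?cards0 ?cards2 ?naa; last first.
    apply/setP => x; rewrite !inE; apply/negbTE/negP => /andP[xa xc].
    have E1 : rt x = rt a by case/orP: xa => /eqP->.
    have E2 : rt x = rt d by case/orP: xc => [/orP[]|] /eqP->.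
    by rewrite -E1 E2 eqxx in nda.
  by rewrite setUC cardsU1 cards2 !inE negb_or !(eq_sym d) ncd nc'd ncc.
have memS x : x \in S = [|| x == a, x == a', x == c, x == c' | x == d].
  by rewrite !inE -!orbA.
have nad : rt a != rt d by rewrite eq_sym.
have /negP[] : ~~ sprime (X :|: S).
  apply: no_odd; rewrite ?cS //; apply/subsetP => x; rewrite memS inE.
  by case/orP=> [|/or4P[]] /eqP->;
    rewrite ?(gam_out ac) ?(gam_out a'c') ?(gam_outr ac) ?(gam_outr a'c') ?(gam_out da).
apply: (sprime_separated X_prime X_gt3 XT no_one_point_extension); rewrite ?subsetT // -/rt -/dv.
  move=> p; rewrite memS.
  case/orP=> [|/or4P[]] /eqP->.
  - by exists d; rewrite ?memS ?eqxx ?orbT // nda dvC dda.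
  - by exists d; rewrite ?memS ?eqxx ?orbT // Ea nda dvC dda'.
  - by exists a; rewrite ?memS ?eqxx ?orbT // Ec nad dvC dac.
  - by exists a'; rewrite ?memS ?eqxx ?orbT // Ec' Ea nad dvC da'c'.
  - by exists a; rewrite ?memS ?eqxx ?orbT // nad dda.
(* The point [c] separates [a] from [a'], [a] separates [c'] from [c] and [d], and [a'] separates
   [c] from [d]. *)
have sep p r : p \in S -> r \in S -> p != r -> rt p = rt r ->
    [exists x in S, (rt x != rt p) && (dv p x != dv r x)].
  have wit x s t : x \in S -> (rt x != rt s) && (dv s x != dv t x) ->
      [exists x in S, (rt x != rt s) && (dv s x != dv t x)].
    by move=> xS H; apply/exists_inP; exists x.
  have [aS a'S] : a \in S /\ a' \in S by rewrite !memS !eqxx !orbT.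
  have [[xS c'S] dS] : (c \in S /\ c' \in S) /\ d \in S by rewrite !memS !eqxx !orbT.
  have H := (Ea, Ec, Ec', nda, nad, dac, da'c', dda, dda', nda'c, ndac',
    (dvC c a, dvC c' a, dvC c a', dvC c' a')).
  rewrite memS [r \in S]memS => /orP[|/or4P[]] /eqP-> /orP[|/or4P[]] /eqP->;
  rewrite ?eqxx // => _ E;
  try (by exfalso; move: E; rewrite ?Ea ?Ec ?Ec' => E; rewrite E eqxx in nda).
  all: try (by exfalso; move: E; rewrite ?Ea ?Ec ?Ec' => E; rewrite E eqxx in nad).
  - by apply: (wit c); rewrite // ?H.
  - by apply: (wit c); rewrite // ?H.
  - by apply: (wit a); rewrite // ?H.
  - by apply: (wit a'); rewrite // ?H.
  - by apply: (wit a); rewrite // ?H.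
  - by apply: (wit a); rewrite // ?H.
  - by apply: (wit a'); rewrite // ?H.
  - by apply: (wit a); rewrite // ?H.
by move=> p r pS rS npr Epr; have /exists_inP[x] := sep p r pS rS npr Epr; exists x.
Qed.

Lemma nbh_proper a a' d : gam d a -> gam d a' -> a != a' ->
  #|nbh a'| <= #|nbh a| -> nbh a' \proper nbh a.
Proof.
move=> da da' naa le; have Ea : rt a' = rt a.
  by apply: gam_trans (_ : gam a' d) da; rewrite gamC.
rewrite properEneq; apply/andP; split.
  apply: contraNneq naa => E; apply/eqP/gam_twin_free => //; first exact: gam_outr da.
  by move=> c; move/setP/(_ c): E; rewrite !inE !(gamC c).
case/orP: (nbh_comparable da da') => // sub.
by have /eqP<- : nbh a == nbh a' by rewrite eqEcard sub.
Qed.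

Definition mate a :=
  odflt a [pick b | gam a b && [forall c, gam a c ==> (#|nbh b| <= #|nbh c|)]].

Lemma mateP a : a \notin X ->
  gam a (mate a) /\ forall c, gam a c -> #|nbh (mate a)| <= #|nbh c|.
Proof.
move=> /gam_nonisolated[b ab]; rewrite /mate; case: pickP => [b' /andP[ab' /forallP min]|no].
  by split=> // c ac; apply: (implyP (min c)).
case: (@arg_minnP _ b (gam a) (fun c => #|nbh c|) ab) => m am min.
have := no m; rewrite am => /forallP[] c; apply/implyP; exact: min.
Qed.

(** Let [b] be the mate of [a] and suppose the mate [a'] of [b] is not [a]. By minimality the
    neighbourhood of [a'] is properly inside that of [a]; take [b'] in the difference. Minimality of
    [b] then puts the neighbourhood of [b] inside that of [b'], but [a'] is in the first and not in
    the second. *)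
Lemma mateK a : a \notin X -> mate (mate a) = a.
Proof.
move=> aX; have [ab minb] := mateP aX; set b := mate a in ab minb *.
have bX := gam_outr ab; have [ba' min'] := mateP bX; set a' := mate b in ba' min' *.
apply/eqP/negPn/negP; rewrite eq_sym => naa.
have ba : gam b a by rewrite gamC.
have /properP[_ [b' ab' na'b']] := nbh_proper ba ba' naa (min' _ ba).
rewrite !inE in ab' na'b'.
have nbb : b' != b by apply: contraNneq na'b' => ->; rewrite gamC.
have le := minb _ ab'.
have /proper_sub/subsetP/(_ a') := nbh_proper ab' ab nbb le.
by rewrite !inE !(gamC _ a') (negbTE na'b') gamC ba' => /(_ isT).
Qed.

Lemma codim_even : ~~ odd #|~: X|.
Proof.
apply: (@even_card_involution _ mate) => a; rewrite !inE => aX.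
have [am _] := mateP aX; split; first exact: gam_outr am.
- exact: mateK.
- by rewrite eq_sym gam_neq.
Qed.

End OddCodim.

(** If an odd set S of at most 5 points keeps X prime, adding it leaves an even number of points,
    positive because more than 5 were outside. If there is none, [codim_even] contradicts
    oddness. *)
Lemma codim_two X : sprime X -> 3 < #|X| -> sprime [set: W] ->
  (0 < #|~: X|) && ~~ odd #|~: X| || (5 < #|~: X|) ->
  exists Y, [/\ X \subset Y, sprime Y & #|~: Y| = 2].
Proof.
move=> pX X3 pW; case E: (odd #|~: X|); last first.
  by move=> c; apply: even_codim_two; rewrite ?E //; case: #|_| c.
rewrite andbF /= => c5.
have [/existsP[S /and4P[SX oS S5 pS]]|/existsPn no] := boolP [exists S : {set W},
    [&& S \subset ~: X, odd #|S|, #|S| <= 5 & sprime (X :|: S)]].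
  have XS : X \subset X :|: S by apply: subsetUl.
  have cXS : #|~: X| = #|~: (X :|: S)| + #|S|.
    by rewrite setCU -setDE -(cardsID S (~: X)) (setIidPr SX) addnC.
  have [|||Y [XSY pY cY]] := even_codim_two pS _ pW.
  - by apply: leq_trans X3 (subset_leq_card XS).
  - by rewrite -(ltn_add2r #|S|) -cXS; apply: leq_ltn_trans S5 c5.
  - by move: E; rewrite cXS oddD oS addbT => ->.
  by exists Y; split=> //; apply: subset_trans XSY.
suff : ~~ odd #|~: X| by rewrite E.
apply: codim_even => // S SX oS S5; have := no S.
by rewrite SX oS S5.
Qed.

End TwoGraph.

Lemma consecutiveC a b : consecutive a b = consecutive b a.
Proof. exact: orbC. Qed.

(** Here [i] and [k] are the two neighbours of [j]. A vertex at distance 2 from [j] exists on one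
    side since the path has at least 4 vertices, and it sees only one of them. *)
Lemma path_two_neighbors m i j k : 3 < m -> i < m -> j < m -> k < m -> k != i ->
  consecutive i j -> consecutive k j ->
  exists2 l, l < m & (consecutive l i != consecutive l k) && ~~ consecutive l j.
Proof.
rewrite /consecutive => m3 im jm km ki ij kj.
by case: (leqP 2 j) => j2; [exists (j - 2) | exists (j + 2)]; lia.
Qed.

Lemma not_consecutive i j k : j < i -> k != i -> i <= k -> consecutive j k = false.
Proof. rewrite /consecutive; lia. Qed.

(** * Paths with an isolated point *)

Section SwitchedPath.
Variables (W : finType) (e : rel W).
Hypothesis e_sym : symmetric e.

(** After switching by [f], the sequence [ws] is an induced path and [o] is isolated. *)
Definition switched_path (f : W -> bool) (ws : seq W) (o : W) :=
  [/\ o \notin ws, uniq ws,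
      forall i j, i < size ws -> j < size ws -> i != j ->
        e (nth o ws i) (nth o ws j) =
        f (nth o ws i) (+) f (nth o ws j) (+) consecutive i j
    & forall i, i < size ws -> e (nth o ws i) o = f (nth o ws i) (+) f o].

(** Take the side A without [o]. Using [o] as one of the four points, flatness says that members of
    A have the same path neighbours outside A. A path on at least 4 vertices has only trivial sets
    of this kind. *)
Lemma sprime_switched_path f ws o : 3 < size ws -> switched_path f ws o ->
  sprime e (o |: [set x in ws]).
Proof.
move=> ws_gt3 [ows uws ePath eo]; set Y := _ |: _; set m := size ws in ws_gt3 *.
pose w i := nth o ws i.
have wY i : i < m -> w i \in Y by move=> im; rewrite !inE mem_nth ?orbT.
have main (A : {set W}) : A \subset Y -> flat e Y A -> o \notin A ->
    (#|A| <= 1) || (#|Y :\: A| <= 1).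
  move=> AY fA oA.
  have oYA : o \in Y :\: A by rewrite !inE oA eqxx.
  have key i k j : i < m -> k < m -> j < m -> w i \in A -> w k \in A -> w j \notin A ->
      consecutive i j = consecutive k j.
    move=> im km jm iA kA jA.
    have [nij nkj] : i != j /\ k != j.
      by split; apply: contraNneq jA => <-.
    have jYA : w j \in Y :\: A by rewrite inE jA wY.
    have := flatP _ _ _ fA (w i) (w k) (w j) o iA kA jYA oYA.
    rewrite /cross /w !ePath // !eo //.
    by do 4!case: (f _); do 2!case: (consecutive _ _).
  have AE x : x \in A -> exists2 i, i < m & x = w i.
    move=> xA; have := subsetP AY _ xA; rewrite !inE.
    case: eqP => [E|_] /= xws; first by rewrite -E xA in oA.
    by exists (index x ws); rewrite ?index_mem // /w nth_index.
  have [/forallP all_eq|] := boolP [forall i : 'I_m, (w i \in A) == (w 0 \in A)].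
    have [w0|w0] := boolP (w 0 \in A).
      apply/orP; right; apply: leq_trans (_ : #|[set o]| <= 1); last by rewrite cards1.
      apply/subset_leq_card/subsetP => x; rewrite !inE => /andP[xA /orP[//|xws]].
      have im : index x ws < m by rewrite index_mem.
      by have := all_eq (Ordinal im); rewrite /= /w nth_index // w0 (negbTE xA).
    suff -> : A = set0 by rewrite cards0.
    apply/eqP; rewrite -subset0; apply/subsetP => x xA; case: (AE x xA) => i im Ex.
    by have := all_eq (Ordinal im); rewrite /= -Ex xA (negbTE w0).
  move=> nall; have [i [im Ei]] : exists i, i.+1 < m /\ (w i \in A) != (w i.+1 \in A).
    case: (boolP [exists i : 'I_m, (i.+1 < m) && ((w i \in A) != (w i.+1 \in A))]).
      by case/existsP=> i /andP[? ?]; exists i.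
    move/existsPn=> no; case/negP: nall; apply/forallP => -[i im] /=.
    elim: i im => // i IH im; have im' := ltnW im.
    by have := no (Ordinal im'); rewrite /= im negbK => /eqP<-; apply: IH.
  have {i im Ei} [i [j [im jm iA jA cij]]] :
      exists i j, [/\ i < m, j < m, w i \in A, w j \notin A & consecutive i j].
    have [iA|iA] := boolP (w i \in A); rewrite ?iA ?(negbTE iA) in Ei.
      by exists i, i.+1; split; rewrite ?(ltnW im) ?(negbTE Ei) // /consecutive eqxx.
    exists i.+1, i; split; rewrite ?(ltnW im) // /consecutive ?eqxx ?orbT //.
    by case: (_ \in A) Ei.
  suff uniq_i k : k < m -> w k \in A -> k = i.
    apply/orP; left; apply/card_le1_eqP => p r pA rA.
    have [k km Ep] := AE p pA; have [l lm Er] := AE r rA.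
    by rewrite Ep Er (uniq_i k) -?Ep // (uniq_i l) -?Er.
  move=> km kA; apply/eqP/negPn/negP => nki.
  have ckj : consecutive k j by rewrite -(key i).
  have in_A l : l < m -> consecutive l i != consecutive l k -> w l \in A.
    by move=> lm; apply: contraR => lA; rewrite !(consecutiveC l) (key i k).
  have out l : l < m -> w l \in A -> consecutive l j.
    by move=> lm lA; rewrite -(key i).
  have [l lm /andP[/(in_A l lm) lA /negP[]]] := path_two_neighbors ws_gt3 im jm km nki cij ckj.
  exact: out.
apply/sprimeP => A AY fA; have [oA|] := boolP (o \in A); last exact: main.
by rewrite orbC -{2}(setDDK AY) main ?subsetDl ?flatC // inE oA.
Qed.

Lemma not_sprime_cut f (Y A : {set W}) : A \subset Y -> 1 < #|A| -> 1 < #|Y :\: A| ->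
  (forall a c, a \in A -> c \in Y :\: A -> e a c = f a (+) f c) -> ~~ sprime e Y.
Proof.
move=> AY cA cB cut; apply/negP => /sprimeP/(_ A AY) pY.
have /pY/orP[] : flat e Y A; [|by rewrite leqNgt cA|by rewrite leqNgt cB].
apply/flatP => a b c d aA bA cY dY; rewrite /cross !cut //.
by do 4!case: (f _).
Qed.

(** Deleting the first vertex and an inner vertex cuts the path into two pieces with no edge between
    them after switching. *)
Lemma switched_path_delete f ws o i : 5 < size ws -> switched_path f ws o ->
  2 <= i -> i.+2 <= size ws -> 
  ~~ sprime e ((o |: [set x in ws]) :\: [set nth o ws 0; nth o ws i]).
Proof.
move=> ws_gt5 [ows uws ePath eo] i2 im; set Y := _ :\: _; set m := size ws in ws_gt5 im *.
pose w j := nth o ws j; have im1 : i < m := ltnW im; have m0 : 0 < m := leq_ltn_trans (leq0n i) im1.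
have w_inj j k : j < m -> k < m -> (w j == w k) = (j == k).
  by move=> jm km; apply: nth_uniq.
have wo j : j < m -> (w j == o) = false.
  by move=> jm; apply/negP => /eqP E; rewrite -E mem_nth in ows.
have wY j : j < m -> j != 0 -> j != i -> w j \in Y.
  move=> jm j0 ji; rewrite !inE mem_nth // orbT andbT -/(w j) -/(w 0) -/(w i).
  by rewrite !w_inj // negb_or j0.
have oY : o \in Y.
  by rewrite !inE eqxx andbT negb_or -/(w 0) -/(w i) ![o == _]eq_sym !wo.
(* For [i = 2] the first piece is a single vertex, so [o] joins it; otherwise [o] goes to the other
   side. This leaves two points on each side. *)
pose A := [set w (val j) | j : 'I_m & 0 < j < i] :|: (if i == 2 then [set o] else set0).
have wAY j : 0 < j < i -> w j \in Y.
  by move=> /andP[j0 ji]; apply: wY; rewrite -?lt0n ?(ltn_eqF ji) // (ltn_trans ji).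
have AY : A \subset Y.
  apply/subsetP => x /setUP[/imsetP[j]|]; first by rewrite inE => ij ->; apply: wAY.
  by case: ifP; rewrite inE // => _ /eqP->.
have inA j : j < m -> (w j \in A) = (0 < j < i).
  move=> jm; rewrite inE orbC; have -> /= : (w j \in if i == 2 then [set o] else set0) = false.
    by case: ifP; rewrite inE // wo.
  apply/imsetP/idP => [[k]|ji]; last by exists (Ordinal jm); rewrite ?inE.
  by rewrite inE => ki /eqP; rewrite w_inj // => /eqP->.
have oA : (o \in A) = (i == 2).
  rewrite inE; case: imsetP => [[k _ /eqP]|_] /=; first by rewrite eq_sym wo.
  by case: ifP; rewrite inE ?eqxx.
have memY x : x \in Y -> x = o \/ exists j, [/\ j < m, j != 0, j != i & x = w j].
  rewrite !inE => /andP[+ /orP[/eqP->|xws]]; first by left.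
  have jm : index x ws < m by rewrite index_mem.
  rewrite -[x](nth_index o xws) -/(w _) -/(w 0) -/(w i) !w_inj // negb_or => /andP[j0 ji].
  by right; exists (index x ws).
have i1 : 1 < i by [].
apply: (@not_sprime_cut f _ A) => //.
- apply/card_gt1P; exists (w 1); have [i2'|i2'] := eqVneq i 2.
    by exists o; rewrite oA inA ?i2' //= ?wo // (leq_trans _ ws_gt5).
  have i3 : 2 < i by rewrite ltn_neqAle eq_sym i2'.
  have m2 : 2 < m by apply: leq_trans ws_gt5.
  by exists (w 2); rewrite !inA ?w_inj ?i3 ?i1 // (ltn_trans _ m2).
- have wB j : i < j -> j < m -> w j \in Y :\: A.
    move=> ij jm; rewrite in_setD inA // [j < i]ltnNge (ltnW ij) andbF wY //.
      by rewrite -lt0n (leq_trans _ ij).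
    by rewrite gtn_eqF.
  apply/card_gt1P; exists (w i.+1); have [i2'|i2'] := eqVneq i 2.
    have i2m : i.+2 < m by rewrite i2' ltnW.
    by exists (w i.+2); rewrite !wB ?w_inj // ltn_eqF.
  by exists o; rewrite wB // wo // in_setD oA i2' oY.
- move=> a c aA /setDP[cY cA].
  have [Ea|[j [jm j0 ji Ea]]] := memY a (subsetP AY _ aA); have [Ec|[k [km k0 ki Ec]]] := memY c cY.
  + by rewrite Ec -Ea aA in cA.
  + by rewrite Ea Ec e_sym eo // addbC.
  + by rewrite Ea Ec eo.
  rewrite Ea Ec ePath //; last by apply: contraNneq cA => E; rewrite Ec -E -Ea.
  rewrite Ea inA // in aA; rewrite Ec inA // lt0n k0 /= -leqNgt in cA.
  by rewrite (_ : consecutive j k = false) ?addbF //; apply: not_consecutive ki cA; case/andP: aA.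
Qed.

End SwitchedPath.

(** * Intervals as flat cuts *)

Lemma intervalP (V : finType) (G : sgraph V) (I : {set V}) :
  reflect (forall x y z, x \notin I -> y \in I -> z \in I -> G x y = G x z)
          (interval G I).
Proof.
apply: (iffP forallP) => [H x y z xI yI zI | H x].
  have := H x; rewrite xI => /orP[] /forall_inP Hx; first by rewrite !Hx.
  by rewrite (negbTE (Hx _ yI)) (negbTE (Hx _ zI)).
apply/implyP => xI; have [-> |[y yI]] := set_0Vmem I.
  by apply/orP; left; apply/forall_inP => y; rewrite inE.
case xy: (G x y); apply/orP; [left | right]; apply/forall_inP => z zI;
  by rewrite (H x z y) ?xy.
Qed.

Lemma trivial_intervalP (V : finType) (I : {set V}) :
  reflect (#|I| <= 1 \/ I = setT) (trivial_interval I).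
Proof.
apply: (iffP or3P) => [[/eqP->|/eqP->|/existsP[x /eqP->]]|[I1|->]].
- by left; rewrite cards0.
- by right.
- by left; rewrite cards1.
- have [->|[x xI]] := set_0Vmem I; first by constructor 1.
  constructor 3; apply/existsP; exists x; rewrite eq_sym eqEcard sub1set xI.
  by rewrite cards1.
- by constructor 2.
Qed.

Lemma adjC (V : finType) (G : sgraph V) x y : G x y = G y x.
Proof. exact: adj_sym. Qed.

Definition oadj (V : finType) (G : sgraph V) : rel (option V) :=
  fun a b => if (a, b) is (Some x, Some y) then G x y else false.

Lemma oadj_sym (V : finType) (G : sgraph V) : symmetric (oadj G).
Proof. by case=> [x|] [y|] //; apply: adj_sym. Qed.

(* [c] allows for complementation, which does not change [cross]. *)
Lemma indecomposable_embed (U V : finType) (H : sgraph U) (G : sgraph V)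
    (h : U -> V) (c : bool) : injective h ->
  (forall u v, u != v -> H u v = c (+) G (h u) (h v)) ->
  indecomposable H = sprime (oadj G) (None |: [set Some (h u) | u : U]).
Proof.
move=> h_inj hom; set Y := _ |: _.
pose img (I : {set U}) := [set Some (h u) | u in I].
have sh_inj : injective (fun u => Some (h u)) by move=> u v [/h_inj].
have memY u : Some (h u) \in Y by rewrite !inE imset_f.
have YE w : w \in Y -> w = None \/ exists u, w = Some (h u).
  by case/setU1P=> [->|/imsetP[u _ ->]]; [left | right; exists u].
have memI (I : {set U}) u : (Some (h u) \in img I) = (u \in I).
  by rewrite (mem_imset _ _ sh_inj).
have NoneI I : None \notin img I by apply/imsetP => -[].
have imgY I : img I \subset Y by apply/subsetP => w /imsetP[u _ ->].
have cimg I : #|img I| = #|I| by rewrite card_imset.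
have flat_img I : flat (oadj G) Y (img I) = interval H I.
  have out u : u \notin I -> Some (h u) \in Y :\: img I by rewrite inE memI memY andbT.
  have outN : None \in Y :\: img I by rewrite inE NoneI !inE eqxx.
  have diff x y : x \notin I -> y \in I -> x != y by move=> xI; apply: contraTneq => <-.
  apply/flatP/intervalP => [fl x y z xI yI zI | int a b w w' /imsetP[y yI ->] /imsetP[z zI ->]].
    have := fl (Some (h y)) (Some (h z)) (Some (h x)) None.
    rewrite !memI yI zI => /(_ isT isT (out _ xI) outN); rewrite /cross /oadj /= addbF.
    by rewrite !hom ?(diff x) // !(adjC G (h x)); do 2!case: (G _ _).
  have key x : x \in Y :\: img I -> oadj G (Some (h y)) x = oadj G (Some (h z)) x.
    case/setDP=> /YE[->//|[u ->]]; rewrite memI => uI; rewrite /oadj /=.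
    have := int u y z uI yI zI; rewrite !hom ?(diff u) // !(adjC G _ (h u)).
    by move/addbI.
  by move=> /key kw /key kw'; rewrite /cross kw kw' !addbb.
apply/forallP/sprimeP => [indec A AY fA | pY I].
  wlog NA : A AY fA / None \notin A.
    move=> IH; have [NA|] := boolP (None \in A); last exact: IH.
    rewrite orbC -{2}(setDDK AY); apply: IH; rewrite ?subsetDl ?flatC ?inE ?NA //.
    exact: oadj_sym.
  pose I := [set u | Some (h u) \in A].
  have EA : A = img I.
    apply/setP => w; apply/idP/imsetP => [wA|[u + ->]]; last by rewrite inE.
    have := subsetP AY _ wA => /YE[E|[u E]]; first by rewrite E (negbTE NA) in wA.
    by exists u; rewrite // inE -E.
  have := indec I; rewrite -flat_img -EA fA => /trivial_intervalP[I1|IT].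
    by rewrite EA cimg I1.
  apply/orP; right; apply: leq_trans (_ : #|[set @None V]| <= 1); last by rewrite cards1.
  apply/subset_leq_card/subsetP => w /setDP[/YE[->|[u ->]]]; rewrite ?inE //.
  by rewrite EA memI IT inE.
apply/implyP; rewrite -flat_img => fI; apply/trivial_intervalP.
have /orP[] := pY _ (imgY I) fI; rewrite ?cimg; first by left.
move=> /card_le1_eqP c1; right; apply/setP => u; rewrite inE; apply/negPn/negP => uI.
have := c1 None (Some (h u)); rewrite !in_setD NoneI memI uI memY !inE eqxx.
by move=> /(_ isT isT).
Qed.

Lemma indecomposable_sprime (V : finType) (G : sgraph V) :
  indecomposable G = sprime (oadj G) setT.
Proof.
rewrite (@indecomposable_embed V V G G id false) //; congr (sprime _ _).
apply/setP => -[x|]; rewrite !inE //.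
by apply/orP; right; apply/imsetP; exists x.
Qed.

(** * Transfer along isomorphisms and complementation *)

Lemma indecomposable_delete (U V : finType) (H : sgraph U) (G : sgraph V)
    (h : U -> V) (c : bool) (S : {set U}) : bijective h ->
  (forall u v, u != v -> H u v = c (+) G (h u) (h v)) ->
  indecomposable (delete H S) = sprime (oadj G) (~: [set Some (h u) | u in S]).
Proof.
move=> [g hK gK] hom; have h_inj := can_inj hK.
rewrite (@indecomposable_embed _ V (delete H S) G (h \o val) c); first last.
- by move=> u v nuv /=; apply: hom.
- exact: inj_comp h_inj val_inj.
congr (sprime _ _); apply/setP => -[x|]; rewrite !inE /=; last first.
  by apply/esym/imsetP => -[].
apply/imsetP/negP => [[[u uS] _ [->]] /imsetP[v vS [/h_inj E]]|noS].
  by rewrite inE E vS in uS.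
have xS : g x \in ~: S.
  by rewrite inE; apply/negP => gS; case: noS; apply/imsetP; exists (g x); rewrite ?gK.
by exists (Sub (g x) xS); rewrite //= gK.
Qed.

(** With [c] true and [h] the identity: a graph and its complement have the same indecomposability
    graph. *)
Lemma indec_graph_iso (U V : finType) (H : sgraph U) (G : sgraph V)
    (h : U -> V) (c : bool) : bijective h ->
  (forall u v, u != v -> H u v = c (+) G (h u) (h v)) ->
  forall u v, indec_graph H u v = indec_graph G (h u) (h v).
Proof.
move=> h_bij hom u v; rewrite /= (bij_eq h_bij); congr (_ && _).
rewrite (indecomposable_delete _ h_bij hom).
rewrite (@indecomposable_delete V V G G id false) //; last by exists id.
by rewrite !imsetU !imset_set1.
Qed.

Lemma indecomposable_iso (U V : finType) (H : sgraph U) (G : sgraph V)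
    (h : U -> V) (c : bool) : bijective h ->
  (forall u v, u != v -> H u v = c (+) G (h u) (h v)) ->
  indecomposable H = indecomposable G.
Proof.
move=> h_bij hom; rewrite (indecomposable_embed (bij_inj h_bij) hom).
rewrite indecomposable_sprime; congr (sprime _ _).
apply/setP => -[x|]; rewrite !inE //; case: h_bij => g hK gK.
by apply/orP; right; apply/imsetP; exists (g x); rewrite ?gK.
Qed.

(** * P_m and Q_m as switched paths *)

Section Shapes.
Variables (V : finType) (G : sgraph V) (s : seq V).
Hypothesis s_uniq : uniq s.
Let m := size s.
Variable x0 : V.

Lemma path_switched : 
  (forall i j, i < m -> j < m -> G (nth x0 s i) (nth x0 s j) = consecutive i.+1 j.+1) ->
  switched_path (oadj G) (fun=> false) [seq Some z | z <- s] None.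
Proof.
move=> Gs; split; rewrite ?size_map.
- by apply/mapP => -[].
- by rewrite map_inj_uniq // => u v [].
- by move=> i j im jm _; rewrite !(nth_map x0) // /oadj /= Gs.
- by move=> i im; rewrite (nth_map x0).
Qed.

(* Switching at the vertex m-1 of Q_m makes m isolated and joins None to the end
   of the path 1, ..., m-1. *)
Lemma Q_switched : 3 < m ->
  (forall i j, i < m -> j < m -> G (nth x0 s i) (nth x0 s j) = Q_adj m i.+1 j.+1) ->
  switched_path (oadj G) (pred1 (Some (nth x0 s (m - 2))))
    (rcons [seq Some z | z <- take m.-1 s] None) (Some (nth x0 s m.-1)).
Proof.
move=> m3 Gs.
have szt : size (take m.-1 s) = m.-1 by rewrite size_takel // leq_pred.
have m0 : 0 < m by apply: leq_trans m3.
have nthE o i : i < m -> nth o (rcons [seq Some z | z <- take m.-1 s] None) i =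
    if i < m.-1 then Some (nth x0 s i) else None.
  move=> im; rewrite nth_rcons size_map szt; case: ifP => im1.
    by rewrite (nth_map x0) ?szt // nth_take.
  by rewrite (_ : i == m.-1) // eqn_leq -ltnS prednK // im leqNgt im1.
have sz : size (rcons [seq Some z | z <- take m.-1 s] None) = m.
  by rewrite size_rcons size_map szt prednK.
have nth_eq i j : i < m -> j < m -> (nth x0 s i == nth x0 s j) = (i == j).
  by move=> im jm; apply: nth_uniq.
have m1 : m.-1 < m by rewrite prednK.
have m2 : m - 2 < m by clear -m3; lia.
have inj_S : injective (@Some V) by move=> u v [].
have NS (z : V) : (None == Some z) = false by [].
split.
- rewrite mem_rcons inE /= mem_map //; apply/negP => /(nthP x0)[i]; rewrite szt => im.
  rewrite nth_take // => /eqP; rewrite nth_eq // ?(ltn_trans im) // => /eqP E.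
  by rewrite E ltnn in im.
- rewrite rcons_uniq map_inj_uniq // take_uniq // andbT.
  by apply/mapP => -[].
- rewrite sz => i j im jm nij; rewrite !nthE //.
  case: ifP => im1; case: ifP => jm1; rewrite /oadj /= ?NS ?(inj_eq inj_S) ?nth_eq ?Gs //.
  + by rewrite /Q_adj /consecutive; clear -m3 im1 jm1 nij; lia.
  + by rewrite /consecutive; clear -m3 im1 im jm jm1 nij; lia.
  + by rewrite /consecutive; clear -m3 im1 im jm jm1 nij; lia.
  + by rewrite /consecutive; clear -m3 im1 im jm jm1 nij; lia.
- rewrite sz => i im; rewrite nthE //.
  case: ifP => im1; rewrite /oadj /= ?NS ?(inj_eq inj_S) ?nth_eq ?Gs //.
    by rewrite /Q_adj /consecutive; clear -m3 im1 im; lia.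
  by clear -m3 im1 im; lia.
Qed.

End Shapes.

(** * Induced P_m or Q_m through two vertices *)

(** In a walk of minimal length from [x] into B, a repeated vertex, a chord or an earlier visit to B
    would give a shorter walk. *)
Lemma shortest_path (T : finType) (R : rel T) (x : T) (B : pred T) :
  symmetric R -> irreflexive R -> (exists2 v, connect R x v & B v) ->
  exists p, let s := x :: p in
    [/\ path R x p, B (last x p), uniq s,
        forall i, i < size p -> ~~ B (nth x s i)
      & forall i j, i < size s -> j < size s ->
          R (nth x s i) (nth x s j) = consecutive i j].
Proof.
move=> R_sym R_irr [v /connectP[q pq ->] Bq].
pose P n := [exists t : n.-tuple T, path R x t && B (last x t)].
have exP : exists n, P n.
  by exists (size q); apply/existsP; exists (in_tuple q); rewrite pq.
case: (ex_minnP exP) => n /existsP[t /andP[pt Bt]] min_n.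
have min r : path R x r -> B (last x r) -> n <= size r.
  by move=> pr Br; apply: min_n; apply/existsP; exists (in_tuple r); rewrite pr.
pose p := tval t; have szp : size p = n by rewrite size_tuple.
rewrite -/p in pt Bt; exists p; set s := x :: p.
have splitp i : i <= n -> [/\ path R x (take i p), path R (nth x s i) (drop i p),
    last x (take i p) = nth x s i & last (nth x s i) (drop i p) = last x p].
  move=> ni; have E : last x (take i p) = nth x s i.
    by rewrite (last_nth x) size_takel ?szp //; case: i ni => //= i ni; rewrite nth_take.
  move: pt; rewrite -{1}(cat_take_drop i p) cat_path E => /andP[-> ->].
  by split=> //; rewrite -{2}(cat_take_drop i p) last_cat E.
have minr i r : i <= n -> path R (nth x s i) r -> B (last (nth x s i) r) -> n - i <= size r.
  move=> ni pr Br; have [pi _ E _] := splitp i ni.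
  have := min (take i p ++ r); rewrite cat_path last_cat E pi size_cat size_takel ?szp //.
  by move=> /(_ pr Br); rewrite leq_subLR.
have inj i j : i < j -> j <= n -> nth x s i != nth x s j.
  move=> ij jn; apply/eqP => E; have [_ pj _ Ej] := splitp j jn.
  have := minr i (drop j p) (ltnW (leq_trans ij jn)); rewrite E Ej size_drop szp.
  by move=> /(_ pj Bt); rewrite leqNgt ltn_sub2l // (leq_trans ij).
have chord i j : i < j -> j <= n -> R (nth x s i) (nth x s j) -> j = i.+1.
  move=> ij jn Rij; have [_ pj _ Ej] := splitp j jn.
  have := minr i (nth x s j :: drop j p) (ltnW (leq_trans ij jn)).
  rewrite /= Rij pj Ej size_drop szp => /(_ isT Bt) le.
  by apply/eqP; rewrite eqn_leq ij andbT; clear -le ij jn; lia.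
have step i : i < n -> R (nth x s i) (nth x s i.+1).
  by move=> ni; have /pathP := pt; apply; rewrite szp.
split=> //.
- apply/(uniqP x) => i j; rewrite !inE /= szp !ltnS => ni nj E.
  case: (ltngtP i j) => // lt; first by have := inj i j lt nj; rewrite E eqxx.
  by have := inj j i lt ni; rewrite E eqxx.
- move=> i; rewrite szp => ni; apply/negP => Bi.
  by have := minr i [::] (ltnW ni) isT Bi; rewrite leqn0 subn_eq0 leqNgt ni.
- move=> i j /=; rewrite szp !ltnS => ni nj.
  wlog le : i j ni nj / i <= j.
    by move=> IH; case/orP: (leq_total i j) => le; [|rewrite R_sym consecutiveC]; apply: IH.
  rewrite /consecutive (gtn_eqF (_ : i < j.+1)) // orbF.
  case: eqP => [Ej|nij]; first by rewrite -Ej step // Ej.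
  move: le; rewrite leq_eqVlt => /orP[/eqP->|lt]; first exact: R_irr.
  by apply/negP => /(chord i j lt nj) E; case: nij.
Qed.

Section MinimalContaining.
Variables (V : finType) (G : sgraph V).

Definition shape (b : bool) m i j :=
  if b then Q_adj m i.+1 j.+1 else consecutive i.+1 j.+1.

Definition has_shape b (s : seq V) (x0 : V) :=
  forall i j, i < size s -> j < size s ->
    G (nth x0 s i) (nth x0 s j) = shape b (size s) i j.

Section CommonNeighbours.
Variable (C : pred V).

Let R a b := [&& G a b, ~~ C a & ~~ C b].

Let R_sym : symmetric R.
Proof. by move=> a b; rewrite /R adjC; case: (C a); case: (C b). Qed.

Let R_irr : irreflexive R.
Proof. by move=> a; rewrite /R adj_irr. Qed.

Let conn_sym : connect_sym R.
Proof. exact: sym_connect_sym. Qed.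

Let pathNC x p : ~~ C x -> path R x p -> all (fun v => ~~ C v) p.
Proof.
by elim: p x => //= y p IH x _ /andP[/and3P[_ _ Cy] /(IH _ Cy)->]; rewrite Cy.
Qed.

Let connNC x v : ~~ C x -> connect R x v -> ~~ C v.
Proof.
move=> Cx /connectP[p /(pathNC Cx)/allP aC ->].
by have := mem_last x p; rewrite inE => /orP[/eqP->//|/aC].
Qed.

Lemma path_of_connect x y : (forall z, C z = G x z && G y z) ->
  x != y -> ~~ G x y -> connect R x y ->
  exists s, [/\ uniq s, 3 < size s, has_shape false s x,
    nth x s 0 = x & nth x s (size s).-1 = y].
Proof.
move=> CE nxy xy cxy.
have Cx : ~~ C x by rewrite CE adj_irr.
have [|p [pp /eqP Ep us _ Rs]] := shortest_path (B := pred1 y) R_sym R_irr (x := x).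
  by exists y => //=.
set s := x :: p in us Rs; exists s.
have NCs i : i < size s -> ~~ C (nth x s i).
  case: i => [//|i] ip; exact: (allP (pathNC Cx pp)) (mem_nth _ _).
have Gs : has_shape false s x.
  by move=> i j im jm; have := Rs i j im jm; rewrite /R !NCs // !andbT.
split=> //; last by rewrite -[(size s).-1]/(size p) -last_nth.
(* At most three vertices are impossible: [x] and [y] are distinct and nonadjacent, and a single
   interior vertex would be a common neighbour. *)
rewrite /= !ltnS; move: pp Ep Cx xy {us Rs s NCs Gs}.
case: p => [|a [|b [|c p]]] //=.
- by move=> _ E; rewrite E eqxx in nxy.
- by rewrite /R andbT => /and3P[xa _ _] <- _; rewrite xa.
- move=> /and3P[/and3P[xa _ Ca] /and3P[ab _ _] _] Eb _ _.
  by rewrite CE xa -Eb adjC ab in Ca.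
Qed.

(** The sequence is a shortest path from [x] to a non-neighbour of [c], then [c], then [y]. On the
    path, [c] misses only the last vertex; [y] sees none of it, being in another component, so [c]
    plays the vertex m-1 of Q_m and [y] the vertex m. *)
Lemma Q_of_separated x y c v : (forall z, C z = G x z && G y z) ->
  x != y -> ~~ connect R x y -> C c -> connect R x v -> ~~ G c v ->
  exists s, [/\ uniq s, 3 < size s, has_shape true s x,
    nth x s 0 = x & nth x s (size s).-1 = y].
Proof.
move=> CE nxy ncxy Cc cxv ncv.
have Cx : ~~ C x by rewrite CE adj_irr.
have Cy : ~~ C y by rewrite CE adj_irr andbF.
have [xc yc] : G x c /\ G y c by move: Cc; rewrite CE => /andP.
have [|p [pp Bp us early Rs]] := shortest_path (B := fun v => ~~ G c v) R_sym R_irr (x := x).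
  by exists v.
set s0 := x :: p in us early Rs; pose n := size s0.
pose s := s0 ++ [:: c; y].
have szs : size s = n.+2 by rewrite size_cat addn2.
have aC : all (fun v => ~~ C v) p := pathNC Cx pp.
have NCs i : i < n -> ~~ C (nth x s0 i).
  case: i => [//|i] ip; exact: (allP aC) (mem_nth _ _).
have conn i : i < n -> connect R x (nth x s0 i).
  move=> im; apply/connectP; exists (take i p).
    by move: pp; rewrite -{1}(cat_take_drop i p) cat_path => /andP[].
  by rewrite (last_nth x) size_takel //; case: i im => //= i im; rewrite nth_take.
have p0 : 0 < size p.
  by case: p Bp {pp us early Rs s0 n s szs aC NCs conn} => //=; rewrite adjC xc.
have lastG i : i < n -> G c (nth x s0 i) = (i != n.-1).
  move=> im; case: eqP => [->|/eqP ni].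
    by apply/negbTE; rewrite (_ : nth x s0 n.-1 = last x p) // nth_last.
  by apply/negPn/early; move: im ni; rewrite /n /=; clear; lia.
have yG i : i < n -> G y (nth x s0 i) = false.
  move=> im; apply/negP => yi; case/negP: ncxy; apply: connect_trans (conn i im) _.
  by apply: connect1; rewrite /R adjC yi NCs // Cy.
have cs0 : c \notin s0.
  by rewrite inE negb_or; apply/andP; split; [apply: contraNneq Cx => <- | apply: contraL Cc => /(allP aC)].
have ys0 : y \notin s0.
  by apply/negP => /(nthP x)[i im E]; case/negP: ncxy; rewrite -E conn.
have ncy : c != y by apply: contraTneq yc => ->; rewrite adj_irr.
exists s; split.
- rewrite cat_uniq us cons_uniq mem_seq1 ncy andbT; apply/hasPn => u.
  by rewrite !inE => /orP[]/eqP->; [exact: cs0 | exact: ys0].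
- by rewrite szs /n /= !ltnS.
- have nthE i : nth x s i = if i < n then nth x s0 i else nth x [:: c; y] (i - n).
    by rewrite nth_cat.
  have Gs0 i j : i < n -> j < n -> G (nth x s0 i) (nth x s0 j) = consecutive i j.
    by move=> im jm; have := Rs i j im jm; rewrite /R !NCs // !andbT.
  have cases i : i < n.+2 -> [\/ i < n /\ nth x s i = nth x s0 i,
      i = n /\ nth x s i = c | i = n.+1 /\ nth x s i = y].
    move=> im; rewrite nthE; case: ltnP => ni; first by constructor 1.
    move: im; rewrite ltnS leq_eqVlt => /orP[/eqP->|].
      by constructor 3; rewrite subSnn.
    by rewrite ltnS => im; constructor 2; have -> : i = n; [apply/eqP; rewrite eqn_leq im | rewrite subnn].
  have n2 : 1 < n by [].
  clearbody n s0 s; clear - cases Gs0 lastG yG szs yc n2.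
  move=> i j; rewrite szs /shape => /cases ci /cases cj.
  case: ci => -[Hi ->]; case: cj => -[Hj ->].
  + by rewrite Gs0 // /Q_adj /consecutive; lia.
  + by rewrite adjC lastG // /Q_adj /consecutive; lia.
  + by rewrite adjC yG // /Q_adj /consecutive; lia.
  + by rewrite lastG // /Q_adj /consecutive; lia.
  + by rewrite adj_irr // /Q_adj /consecutive; lia.
  + by rewrite adjC yc // /Q_adj /consecutive; lia.
  + by rewrite yG // /Q_adj /consecutive; lia.
  + by rewrite yc // /Q_adj /consecutive; lia.
  + by rewrite adj_irr // /Q_adj /consecutive; lia.
- by [].
- by rewrite szs /= nth_cat ltnNge leqnSn /= subSnn.
Qed.

(** Otherwise the union I of the components of [x] and [y] is an interval: vertices of C see all of
    it, other outside vertices none. Then I is everything and C is empty. *)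
Lemma separated_exists x y : (forall z, C z = G x z && G y z) ->
  x != y -> indecomposable G -> 2 < #|V| -> ~~ connect R x y ->
  exists c v, [/\ C c, connect R x v || connect R y v & ~~ G c v].
Proof.
move=> CE nxy indec V3 ncxy.
have Cx : ~~ C x by rewrite CE adj_irr.
have Cy : ~~ C y by rewrite CE adj_irr andbF.
have triv I : interval G I -> #|I| <= 1 \/ I = setT.
  by move=> iI; apply/trivial_intervalP; apply: (implyP (forallP indec I)).
pose I := [set v | connect R x v || connect R y v].
have xI : x \in I by rewrite inE connect0.
have yI : y \in I by rewrite inE connect0 orbT.
case: (boolP [exists c, exists v, [&& C c, v \in I & ~~ G c v]]).
  case/existsP=> c /existsP[v /and3P[? vI ?]]; exists c, v; split=> //.
  by rewrite inE in vI.
move/existsPn=> no; exfalso.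
have INC v : v \in I -> ~~ C v.
  by rewrite inE => /orP[]; apply: connNC.
have IT : I = setT.
  case: (triv I) => // [|c1].
    apply/intervalP => z v w zI vI wI; have [Cz|Cz] := boolP (C z).
      have /existsPn noz := no z.
      by have := noz v; have := noz w; rewrite Cz vI wI /= !negbK => -> ->.
    have out u : u \in I -> G z u = false.
      move=> uI; apply/negP => zu; case/negP: zI.
      have Ruz : R u z by rewrite /R adjC zu INC.
      by move: uI; rewrite !inE => /orP[] c; rewrite (connect_trans c (connect1 Ruz)) ?orbT.
    by rewrite !out.
  by have := card_le1_eqP c1 x y xI yI => E; rewrite E eqxx in nxy.
(* With C empty, the components of [x] and [y] are intervals different from V, hence singletons, and
   G has only two vertices. *)
have NC v : ~~ C v by apply: INC; rewrite IT.
have comp a b v : ~~ connect R a b -> connect R a v -> v = a.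
  move=> nab cav; pose J := [set u | connect R a u].
  have [|c1|JT] := triv J.
  - apply/intervalP => z u w zJ uJ wJ.
    have out t : t \in J -> G z t = false.
      move=> tJ; apply/negP => zt; case/negP: zJ; move: tJ; rewrite !inE => cat.
      by apply: connect_trans cat (connect1 _); rewrite /R adjC zt !NC.
    by rewrite !out.
  - by apply: (card_le1_eqP c1); rewrite inE.
  - by have := in_setT b; rewrite -JT inE (negbTE nab).
have : #|V| <= #|[set x; y]|.
  rewrite -cardsT; apply/subset_leq_card/subsetP => v _.
  have : v \in I by rewrite IT.
  rewrite !inE => /orP[] cv; first by rewrite (comp x y v) ?eqxx.
  by rewrite (comp y x v) ?eqxx ?orbT // conn_sym.
by rewrite cards2 nxy leqNgt V3.
Qed.

End CommonNeighbours.

Lemma shape_containing x y : indecomposable G -> 2 < #|V| -> x != y -> ~~ G x y ->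
  exists b s, [/\ uniq s, 3 < size s, has_shape b s x
    & [set nth x s 0; nth x s (size s).-1] = [set x; y]].
Proof.
move=> indec V3 nxy xy; pose C z := G x z && G y z.
pose R a b := [&& G a b, ~~ C a & ~~ C b].
have [cxy|ncxy] := boolP (connect R x y).
  have [s [us s3 Gs s0 sl]] := @path_of_connect C x y (fun=> erefl) nxy xy cxy.
  by exists false, s; split; rewrite ?s0 ?sl.
have [c [v [Cc /orP[cv|cv] ncv]]] := @separated_exists C x y (fun=> erefl) nxy indec V3 ncxy.
  have [s [us s3 Gs s0 sl]] := @Q_of_separated C x y c v (fun=> erefl) nxy ncxy Cc cv ncv.
  by exists true, s; split; rewrite ?s0 ?sl.
have [s [us s3 Gs s0 sl]] : exists s, [/\ uniq s, 3 < size s, has_shape true s y,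
    nth y s 0 = y & nth y s (size s).-1 = x].
  apply: (@Q_of_separated C y x c v) => //; first by move=> z; rewrite andbC.
    by rewrite eq_sym.
  by rewrite sym_connect_sym // => a b; rewrite /R adjC; case: (C a); case: (C b).
have sz i : i < size s -> nth x s i = nth y s i by move=> im; apply: set_nth_default.
have [l0 l1] : 0 < size s /\ (size s).-1 < size s by case: (size s) s3.
exists true, s; split=> //; first by move=> i j im jm; rewrite !sz // Gs.
by rewrite !sz // s0 sl setUC.
Qed.

(** The last index is excluded at the end because for Q_m the last entry of [ws] is [None], while
    the last vertex of [s] is [o]. *)
Lemma shape_switched b s x0 : uniq s -> 3 < size s -> has_shape b s x0 ->
  exists f ws o, [/\ switched_path (oadj G) f ws o, size ws = size s,
    o |: [set w in ws] = None |: [set Some z | z in s]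
    & forall i, i < (size s).-1 -> nth o ws i = Some (nth x0 s i)].
Proof.
move=> us s3 Gs; case: b Gs => Gs.
  exists (pred1 (Some (nth x0 s (size s - 2)))), (rcons [seq Some z | z <- take (size s).-1 s] None),
    (Some (nth x0 s (size s).-1)).
  have s0 : 0 < size s by apply: leq_trans s3.
  have szt : size (take (size s).-1 s) = (size s).-1 by rewrite size_takel // leq_pred.
  split.
  - by apply: Q_switched => //; exact: Gs.
  - by rewrite size_rcons size_map szt prednK.
  - have -> : [set Some z | z in s] = [set w in [seq Some z | z <- s]].
      by apply/setP => w; rewrite inE; apply/imsetP/mapP => -[z zs ->]; exists z.
    apply/setP => w; rewrite !inE mem_rcons inE.
    have Es : s = rcons (take (size s).-1 s) (nth x0 s (size s).-1).
      by rewrite -take_nth prednK // take_size.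
    have -> : (w \in [seq Some z | z <- s]) = (w == Some (nth x0 s (size s).-1))
        || (w \in [seq Some z | z <- take (size s).-1 s]).
      by rewrite {1}Es map_rcons mem_rcons inE.
    by rewrite orbCA.
  - by move=> i im; rewrite nth_rcons size_map szt im (nth_map x0) ?szt // nth_take.
exists (fun=> false), [seq Some z | z <- s], None; split.
- by apply: (path_switched us (x0 := x0)); exact: Gs.
- by rewrite size_map.
- congr (_ |: _); apply/setP => w; rewrite inE.
  by apply/mapP/imsetP => -[z zs ->]; exists z.
- move=> i im; rewrite (nth_map x0) //; exact: leq_trans im (leq_pred _).
Qed.

End MinimalContaining.

(** * Assembling the classes *)

Lemma shape_shift b m i j : 4 < m -> i < m.-1 -> j < m.-1 ->
  shape b m i.+1 j.+1 = shape b m.-1 i j.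
Proof. by rewrite /shape /Q_adj /consecutive; case: b; lia. Qed.

Lemma pull_sym (U V : finType) (G : sgraph V) (g : U -> V) : symmetric (relpre g G).
Proof. by move=> u v; apply: adj_sym. Qed.

Lemma pull_irr (U V : finType) (G : sgraph V) (g : U -> V) : irreflexive (relpre g G).
Proof. by move=> u; apply: adj_irr. Qed.

Definition pull (U V : finType) (G : sgraph V) (g : U -> V) : sgraph U :=
  SGraph (pull_sym G g) (pull_irr G g).

Lemma in_classes_enumerated (V : finType) (G : sgraph V) b k (t : seq V) x0 :
  k \in [:: 1; 3; 5] -> 13 < size t -> uniq t -> (forall v, v \in t) ->
  indecomposable G ->
  covered_by (indec_graph G) [set nth x0 t 0; nth x0 t (size t - k).-1] ->
  (forall i j, i < size t - k -> j < size t - k ->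
     G (nth x0 t i) (nth x0 t j) = shape b (size t - k) i j) ->
  exists (n : nat) (G' : sgraph 'I_n), [/\ 14 <= n, in_classes G' & isomorphic G G'].
Proof.
move=> kk t14 ut tT indec cov Gt; set n := size t in t14 cov Gt.
pose g (i : 'I_n) := nth x0 t i.
have ind_lt v : index v t < n by rewrite index_mem.
pose f v : 'I_n := Ordinal (ind_lt v).
have fK : cancel f g by move=> v; rewrite /g /= nth_index.
have gK : cancel g f by move=> i; apply: val_inj; rewrite /= index_uniq.
have g_bij : bijective g by exists f.
have hom u v : u != v -> pull G g u v = false (+) G (g u) (g v) by [].
exists n, (pull G g); split=> //; last first.
  by exists f; [exists g | move=> x y /=; rewrite !fK].
have k5 : k <= 5 by move: kk; rewrite !inE => /or3P[]/eqP->.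
have indec' : indecomposable (pull G g) by rewrite (indecomposable_iso g_bij hom).
have cov' : covered_by (indec_graph (pull G g)) (ends n k).
  have mem i : g i \in [set nth x0 t 0; nth x0 t (n - k).-1] -> i \in ends n k.
    have [l0 l1] : 0 < n /\ (n - k).-1 < n by clear -t14 k5; lia.
    rewrite !inE /lab /g !nth_uniq // eqSS => /orP[->//|/eqP->].
    by rewrite prednK ?eqxx ?orbT // subn_gt0; clear -t14 k5; lia.
  move=> u v; rewrite (indec_graph_iso g_bij hom) => /cov/orP[/mem->//|/mem->].
  by rewrite orbT.
have init : initial_part_is (k := k) (pull G g) (if b then Q_graph (n - k) else P_graph (n - k)).
  by move=> i j; rewrite /= /g /= Gt //; case: (b).
case: b Gt init => _ init; [right | left];
  move: kk indec' cov' init; rewrite !inE => /or3P[]/eqP->{k5 cov} *.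
- by constructor 1; split=> //; apply: leq_trans t14.
- by constructor 2; split=> //; apply: leq_trans t14.
- by constructor 3; split=> //; apply: leq_trans t14.
- by constructor 1; split=> //; apply: leq_trans t14.
- by constructor 2; split=> //; apply: leq_trans t14.
- by constructor 3; split=> //; apply: leq_trans t14.
Qed.

(** By [switched_path_delete], the first vertex can be joined in the indecomposability graph only to
    the second and the last one, so the second can replace it in the cover. *)
Lemma spanning_shape_cover (V : finType) (G : sgraph V) b s x0 :
  uniq s -> (forall v, v \in s) -> 13 < size s -> has_shape G b s x0 ->
  covered_by (indec_graph G) [set nth x0 s 0; nth x0 s (size s).-1] ->
  covered_by (indec_graph G) [set nth x0 s 1; nth x0 s (size s).-1].
Proof.
move=> us sT s14 Gs cov.
have [f [ws [o [path_ws szw cover_ws nth_ws]]]] := shape_switched us (ltn_trans (isT : 3 < 13) s14) Gs.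
have main u v : indec_graph G u v -> u = nth x0 s 0 ->
    v \in [set nth x0 s 1; nth x0 s (size s).-1].
  move=> /andP[nuv]; rewrite (@indecomposable_delete V V G G id false) //; last by exists id.
  move=> + Eu; apply: contraTT; rewrite !inE negb_or -{1 2}(nth_index x0 (sT v)).
  set i := index v s; have im : i < size s by rewrite index_mem.
  have [m0 m1 ml] : [/\ 0 < size s, 1 < size s & (size s).-1 < size s] by clear -s14; split; lia.
  rewrite !nth_uniq // => /andP[i1 il].
  have i0 : i != 0.
    by apply: contraNneq nuv => i0; rewrite Eu -i0 nth_index.
  have [i2 im2] : 2 <= i /\ i.+2 <= size ws by rewrite szw; clear -i0 i1 il im; lia.
  have ws6 : 5 < size ws by rewrite szw; apply: leq_trans s14.
  have := switched_path_delete (@oadj_sym _ G) ws6 path_ws i2 im2.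
  rewrite !nth_ws ?nth_index //; [|by clear -im il; lia|by clear -s14; lia].
  rewrite cover_ws -Eu; congr (~~ sprime _ _); apply/setP => w.
  rewrite imsetU !imset_set1 inE [in RHS]inE; case: (w \in [set Some u; Some v]) => //=.
  by case: w => [w|]; rewrite !inE //= imset_f.
move=> u v uv; have vu : indec_graph G v u by rewrite (adj_sym (indec_graph G)).
have := cov u v uv; rewrite !(in_set2 _ (nth x0 s 0)).
case/orP=> /orP[/eqP E|H]; rewrite ?(main _ _ uv E) ?(main _ _ vu E) ?orbT //.
  by rewrite in_set2 H orbT.
by rewrite (in_set2 v) H !orbT.
Qed.

Lemma nonadjacent_cover_class (V : finType) (G : sgraph V) x y :
  indecomposable G -> 14 <= #|V| -> x != y -> ~~ G x y ->
  covered_by (indec_graph G) [set x; y] ->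
  exists (n : nat) (G' : sgraph 'I_n), [/\ 14 <= n, in_classes G' & isomorphic G G'].
Proof.
move=> indec V14 nxy xy cov.
have [b [s [us s3 Gs Exy]]] := shape_containing indec (leq_trans (isT : 3 <= 14) V14) nxy xy.
rewrite -Exy in cov.
have [f [ws [o [path_ws szw cover_ws nth_ws]]]] := shape_switched us s3 Gs.
pose e := oadj G; have e_sym : symmetric e := @oadj_sym _ G.
pose X := None |: [set Some z | z in s].
have pX : sprime e X.
  by rewrite /X -cover_ws; apply: sprime_switched_path path_ws; rewrite ?szw.
have cX : #|X| = (size s).+1.
  rewrite cardsU1 card_imset => [|u v [] //].
  by rewrite (card_uniqP us) (_ : None \in _ = false) //; apply/imsetP => -[].
have cC : #|~: X| = #|V| - size s.
  by have := cardsC X; rewrite cX card_option; clear; lia.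
have sV : size s <= #|V| by rewrite -(card_uniqP us) max_card.
(* Otherwise G stays indecomposable after deleting two vertices outside [s]: an edge of the
   indecomposability graph that misses the cover. *)
have few : ((0 < #|~: X|) && ~~ odd #|~: X| || (5 < #|~: X|)) = false.
  apply/negP => /(codim_two e_sym pX)[].
  - by rewrite cX ltnS ltnW.
  - by rewrite -indecomposable_sprime.
  move=> Y [XY pY /eqP/cards2P[p [q [npq EY]]]].
  have out w : w \notin Y -> exists2 u, w = Some u & u \notin s.
    move=> wY; have : w \notin X by apply: contra wY; apply: subsetP.
    rewrite !inE negb_or; case: w {wY} => //= u us'; exists u => //.
    by apply: contra us' => us'; rewrite imset_f.
  have [|u Eu us'] := out p; first by rewrite -in_setC EY set21.
  have [|v Ev vs'] := out q; first by rewrite -in_setC EY set22.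
  have : indec_graph G u v.
    apply/andP; split; first by apply: contraNneq npq => E; rewrite Eu Ev E.
    rewrite (@indecomposable_delete V V G G id false) //; last by exists id.
    by rewrite imsetU !imset_set1 -Eu -Ev -EY setCK.
  have ins i : i < size s -> nth x s i \in s by apply: mem_nth.
  have [l0 l1] : 0 < size s /\ (size s).-1 < size s by case: (size s) s3.
  move/cov; rewrite !inE => /orP[]/orP[]/eqP E;
  by [move: us'; rewrite E ins | move: vs'; rewrite E ins].
have [E0|k0] := eqVneq (size s) #|V|.
  have sT v : v \in s.
    by have -> := subset_cardP (etrans (card_uniqP us) E0) (subset_predT _) v.
  have s14 : 13 < size s by rewrite E0.
  have [c0 c1 c2] : [/\ 0 < (size s).-1, 1 < size s & (size s).-1.-1 < (size s).-1].
    by clear -s14; split; lia.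
  have nth_rot i : i < (size s).-1 -> nth x (rot 1 s) i = nth x s i.+1.
    by move=> im; rewrite nth_cat size_drop subn1 im nth_drop.
  (* The rotation moves the first vertex to the end, where it becomes the vertex [n] of a class with
     [k = 1]. *)
  apply: (@in_classes_enumerated V G b 1 (rot 1 s) x); rewrite ?size_rot ?rot_uniq ?subn1 //.
  - by move=> v; rewrite mem_rot.
  - by rewrite !nth_rot // prednK //; apply: spanning_shape_cover Gs cov.
  - move=> i j im jm; rewrite !nth_rot // Gs; [|by clear -im; lia|by clear -jm; lia].
    by rewrite shape_shift //; apply: leq_trans s14.
have kk : #|V| - size s \in [:: 1; 3; 5].
  by move: few; rewrite cC !inE; clear -k0 sV; lia.
pose t := s ++ [seq v <- enum V | v \notin s].
have tT v : v \in t by rewrite mem_cat mem_filter mem_enum andbT; case: (v \in s).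
have ut : uniq t.
  rewrite cat_uniq us filter_uniq ?enum_uniq // andbT; apply/hasPn => v.
  by rewrite mem_filter => /andP[].
have szt : size t = #|V|.
  by rewrite -(card_uniqP ut); apply: eq_card => v; rewrite tT.
have sub : size t - (#|V| - size s) = size s by rewrite szt subKn.
have nth_t i : i < size s -> nth x t i = nth x s i by move=> im; rewrite nth_cat im.
have [l0 l1] : 0 < size s /\ (size s).-1 < size s by case: (size s) s3.
apply: (@in_classes_enumerated V G b _ t x kk); rewrite ?sub ?szt //.
- by rewrite !nth_t.
- by move=> i j im jm; rewrite !nth_t // Gs.
Qed.

Theorem theorem1p8 (V : finType) (G : sgraph V) :
  indecomposable G -> 14 <= #|V| ->
  (k_covered 2 (indec_graph G) <->
   exists (n : nat) (G' : sgraph 'I_n),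
     [/\ 14 <= n, in_classes G' & isomorphic G G' \/ isomorphic (compl G) G']).
Proof.
move=> indec V14; split.
  case=> X /eqP/cards2P[x [y [nxy ->]]] cov.
  (* Complementation keeps the indecomposability graph, so [x] and [y] may be taken nonadjacent. *)
  have [xy|xy] := boolP (G x y); last first.
    have [n [G' [n14 cl iso]]] := nonadjacent_cover_class indec V14 nxy xy cov.
    by exists n, G'; split=> //; left.
  have id_bij : bijective (id : V -> V) by exists id.
  have hom u v : u != v -> compl G u v = true (+) G (id u) (id v) by move=> /= ->.
  have [|||||n [G' [n14 cl iso]]] := @nonadjacent_cover_class _ (compl G) x y.
  - by rewrite (indecomposable_iso id_bij hom).
  - exact: V14.
  - exact: nxy.
  - by rewrite /= xy andbF.
  - by move=> u v; rewrite (indec_graph_iso id_bij hom); apply: cov.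
  by exists n, G'; split=> //; right.
case=> n [G' [n14 cl iso]].
have {iso} [f [c [f_bij hom]]] : exists (f : V -> 'I_n) (c : bool),
    bijective f /\ forall u v, u != v -> G u v = c (+) G' (f u) (f v).
  case: iso => -[f f_bij hom]; first by exists f, false; split=> // u v _; rewrite hom.
  by exists f, true; split=> // u v nuv; rewrite hom /= nuv negbK.
have [k k5 cov] : exists2 k, k <= 5 & covered_by (indec_graph G') (ends n k) /\ 0 < k.
  by case: cl => -[] [_ _ cov _]; [exists 1|exists 3|exists 5|exists 1|exists 3|exists 5].
have {cov} [cov k0] := cov.
exists (f @^-1: ends n k); last first.
  by move=> u v; rewrite (indec_graph_iso f_bij hom) !inE => /cov; rewrite !inE.
have [g fK gK] := f_bij.
have l0 : 0 < n by apply: leq_trans n14.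
have l1 : (n - k).-1 < n by clear -n14 k5; lia.
(* The ordinal [(n - k).-1] has label [n - k]; it is not the ordinal 0, as [n >= 14] and
   [k <= 5]. *)
have -> : f @^-1: ends n k = [set g (Ordinal l0); g (Ordinal l1)].
  apply/setP => v; rewrite !inE /lab -!(can2_eq fK gK) -!val_eqE /=.
  by clear -n14 k5 k0; lia.
rewrite cards2 (can_eq gK) -val_eqE /= ; clear -n14 k5.
by case: eqP => //; lia.
Qed.
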